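(* Let $k>1$ and $\Delta\ge1$. Any linear sparse recovery scheme with approximation factor $K$ with respect to $\mathrm{EMD}$ over the square $[\Delta]^2$ requires $$m\ge\frac{\Omega(k)\log\left(\Omega\left(\log\frac{\Delta^2}{k}\right)\right)}{\log K}$$ measurements.
   Context: $[\Delta]=\{1,\dots,\Delta\}$. For non-negative measures $x,y$ on $[\Delta]^2$ of equal total mass, $\mathrm{EMD}(x,y)$ is the minimum cost of transporting $x$ to $y$, where moving mass $w$ from $a$ to $b$ costs $w\|a-b\|$ (distance in the plane). A linear sparse recovery scheme with $m$ measurements and approximation factor $K$ is a probability distribution over pairs $(A,\mathcal{A})$ with $A\in\mathbb{R}^{m\times[\Delta]^2}$ and $\mathcal{A}:\mathbb{R}^m\to\mathbb{R}^{[\Delta]^2}$ such that, for every non-negative input $x$, with probability at least $3/4$ the output $\widehat x=\mathcal{A}(Ax)$ satisfies $\mathrm{EMD}(\widehat x,x)\le K\cdot\min_{k\text{-sparse } x'}\mathrm{EMD}(x,x')$, the minimum being over non-negative $x'$ with at most $k$ nonzero entries and the same total mass as $x$.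
   Formalization: K is bounded away from 1: for each K0 > 1 the Ω-constants depend on K0 and serve all K ≥ K0 (with absolute constants the bound fails as K → 1); and success of recovery is assumed jointly measurable in the random pair and the input x. *)

(* Defs.v *)
From HB Require Import structures.
From mathcomp Require Import all_boot all_order all_algebra.
From mathcomp Require Import all_classical all_reals all_analysis.

Set Implicit Arguments.
Unset Strict Implicit.
Unset Printing Implicit Defensive.

Import Order.TTheory GRing.Theory Num.Theory.
Local Open Scope classical_set_scope.
Local Open Scope ring_scope.

Section EMD.
Context {R : realType} {D : nat}.

(* A point (i, j) stands for (i + 1, j + 1) in {1, ..., D}^2; the shift does
   not affect distances.  A vector of R^([D]^2) is a D x D matrix, whose entry
   x i j is the mass at (i, j). *)
Definition point := ('I_D * 'I_D)%type.

Definition dist (a b : point) : R :=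
  Num.sqrt ((a.1%:R - b.1%:R) ^+ 2 + (a.2%:R - b.2%:R) ^+ 2).

Definition nonneg (x : 'M[R]_D) : Prop := forall i j, 0 <= x i j.

Definition mass (x : 'M[R]_D) : R := \sum_i \sum_j x i j.

Definition sparse (k : nat) (x : 'M[R]_D) : Prop :=
  (#|[set a : point | x a.1 a.2 != 0%R]%SET| <= k)%N.

(* g a b is the amount of mass moved from a to b. *)
Definition transport (x y : 'M[R]_D) (g : point -> point -> R) : Prop :=
  [/\ forall a b, 0 <= g a b,
      forall a, \sum_b g a b = x a.1 a.2
    & forall b, \sum_a g a b = y b.1 b.2].

Definition transport_cost (g : point -> point -> R) : R :=
  \sum_a \sum_b g a b * dist a b.

(* If x and y are not both non-negative with the same total mass, there is no
   transport and emd x y = +oo; otherwise the infimum is a minimum. *)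
Definition emd (x y : 'M[R]_D) : \bar R :=
  ereal_inf [set (transport_cost g)%:E | g in transport x y].

Definition best_sparse_error (k : nat) (x : 'M[R]_D) : \bar R :=
  ereal_inf [set emd x x' | x' in
    [set x' : 'M[R]_D | [/\ nonneg x', sparse k x' & mass x' = mass x]]].

Definition good_output (k : nat) (K : R) (x xhat : 'M[R]_D) : Prop :=
  (emd xhat x <= K%:E * best_sparse_error k x)%E.

(* Used to put the product sigma-algebra of the library, which is defined on
   tuples, on R^([D]^2). *)
Definition mx_of_tuple (t : (D * D).-tuple R) : 'M[R]_D :=
  vec_mx (\row_l tnth t l).

End EMD.

(* The distribution over pairs (A, rec) is the law of a pair defined on a
   probability space (T, P).  Neither the matrix nor the recovery map is
   required to be measurable in itself; only the set of pairs (w, x) for which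
   recovery succeeds is, jointly in w and x (hence so is each event whose
   probability is taken).  Measurability in w alone, for each fixed x, would be
   too weak: under the continuum hypothesis, take T = [0, 1] well-ordered in
   type omega_1, enumerate the inputs by T, and let (A w, rec w) with m = 1
   recover exactly the countably many inputs that precede w; each input is then
   recovered with probability 1. *)
Definition sparse_recovery_scheme (R : realType) (d : measure_display)
    (T : measurableType d) (P : probability T R) (D k m : nat) (K : R)
    (A : T -> 'M[R]_(m, D * D)) (rec : T -> 'cV[R]_m -> 'M[R]_D) : Prop :=
  let success (w : T) (x : 'M[R]_D) :=
    good_output k K x (rec w (A w *m (mxvec x)^T)) in
  measurable [set p : T * (D * D).-tuple R |
    nonneg (mx_of_tuple p.2) /\ success p.1 (mx_of_tuple p.2)] /\
  forall x : 'M[R]_D, nonneg x -> ((3 / 4)%:E <= P [set w | success w x])%E.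

(* Main.v *)
(** Each of n = k/2 far apart cells of the grid carries a center and s leaves,
    the i-th leaf at distance 3^i from its center and bearing mass 3^-i: moving
    any leaf to its center costs 1, so EMD restricted to the leaves behaves like
    the l1 norm.  A codeword picks one leaf in each cell; a scheme with factor K
    recovers a codeword, up to n/2 cells, in the presence of codewords scaled
    down by b = O(K).

    Superpose J codewords with weights 1, b, ..., b^(J-1), and add a tiny uniform
    noise.  The measurement determines the top codeword approximately; once it
    is known exactly it can be subtracted, and so on down.  Hence, for a matrix
    that succeeds on half of the levels, few sequences of codewords are
    compatible with a given measurement.  Translating the noise along at most m
    well chosen coordinates turns this into a packing of about (s^n)^J cubes of
    side eps, with small multiplicity, in a slab whose volume is only
    O(b^(J m)) times that of a cube.  Letting J tend to infinity gives
    s^n <= 4 2^n s^(n/2) b^(2 m). *)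

Require Import Defs.
From HB Require Import structures.
From mathcomp Require Import all_boot all_order all_algebra.
From mathcomp Require Import all_classical all_reals all_analysis.
From mathcomp Require Import measurable_realfun.
From mathcomp Require Import ring lra zify.

Set Implicit Arguments.
Unset Strict Implicit.
Unset Printing Implicit Defensive.

Import Order.TTheory GRing.Theory Num.Theory.

(** * Counting *)

(** Entries are chosen from the last to the first: once those beyond [i] are fixed, [Z i] leaves at
    most [beta i] values for entry [i]. The induction removes the head, whose constraint sees the
    whole tail. *)
Lemma card_guided_tuples (C : finType) (J : nat) (Z : nat -> seq C -> {set C})
    (beta : nat -> nat) :
  (forall i s, #|Z i s| <= beta i) ->
  #|[set t : J.-tuple C | [forall i : 'I_J, tnth t i \in Z i (drop i.+1 t)]]|
    <= \prod_(i < J) beta i.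
Proof.
elim: J Z beta => [|J IH] Z beta ZB.
  rewrite big_ord0; apply: leq_trans (max_card _) _.
  by rewrite card_tuple expn0.
pose S := [set t : J.-tuple C |
  [forall i : 'I_J, tnth t i \in Z i.+1 (drop i.+1 t)]].
pose h (t : J.+1.-tuple C) := ([tuple of behead t], thead t).
have hinj : injective h.
  by move=> s t [] E1 E2; apply/val_inj; rewrite /= (tuple_eta s) (tuple_eta t)/= E1 E2.
rewrite -(card_imset _ hinj).
apply: (@leq_trans #|[set p : J.-tuple C * C | (p.1 \in S) && (p.2 \in Z 0 p.1)]|).
  apply/subset_leq_card/fintype.subsetP => _ /imsetP[t + ->].
  rewrite !inE => /forallP H.
  apply/andP; split; last by have := H ord0; rewrite (tuple_eta t) /= drop0.
  apply/forallP => i; have := H (lift ord0 i); rewrite [in X in X -> _](tuple_eta t).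
  by rewrite tnthS.
rewrite -sum1_card; under eq_bigl do rewrite inE.
rewrite -(pair_big_dep (mem S) (fun p c => c \in Z 0 p) (fun _ _ => 1))/=.
apply: (@leq_trans (\sum_(p in S) beta 0)).
  by apply: leq_sum => p _; rewrite sum1_card.
rewrite sum_nat_const big_ord_recl mulnC leq_mul2l; apply/orP; right.
exact: (IH (fun i => Z i.+1) (fun i => beta i.+1)).
Qed.

(** Since [b <= M], the worst case is the smallest allowed [I], with [J] elements. *)
Lemma prod_two_values_le (J : nat) (I : {set 'I_(J + J)}) (b M : nat) :
  b <= M -> J <= #|I| ->
  \prod_(i < J + J) (if i \in I then b else M) <= (b * M) ^ J.
Proof.
move=> bM JI.
rewrite (bigID (mem I))/= (eq_bigr (fun=> b)); last by move=> i ->.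
rewrite [X in _ * X](eq_bigr (fun=> M)); last by move=> i /negPf ->.
rewrite !prod_nat_const.
have -> : #|[pred i | i \notin I]| = J + J - #|I|.
  have E : #|I| + #|[predC I]| = J + J by rewrite cardC card_ord.
  by rewrite -[X in X - _]E addKn; apply: eq_card.
have IJ : #|I| <= J + J by have := max_card (mem I); rewrite card_ord.
have -> : #|I| = J + (#|I| - J) by rewrite subnKC.
set e := #|I| - J; have -> : J + J - (J + e) = J - e by lia.
rewrite expnD expnMn -mulnA leq_mul2l; apply/orP; right.
rewrite -{2}(@subnKC e J); last by lia.
rewrite expnD leq_mul2r; apply/orP; right.
by case: (e) => [//|e']; rewrite leq_exp2r.
Qed.

(** Union bound over the sets [D] of at most [rho] positions where [c] may leave [c0]; the number of
    such sets is crudely bounded by that of all subsets. *)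
Lemma card_hamming_ball (I S : finType) (c0 : {ffun I -> S}) (rho : nat) :
  0 < #|S| ->
  #|[set c : {ffun I -> S} | #|[set i | c i != c0 i]| <= rho]|
    <= 2 ^ #|I| * #|S| ^ rho.
Proof.
move=> S0.
apply: (@leq_trans #|\bigcup_(D : {set I} | #|D| <= rho)
    [set c in family (fun i => if i \in D then predT else pred1 (c0 i))]|).
  apply/subset_leq_card/fintype.subsetP => c; rewrite inE => cr.
  apply/bigcupP; exists [set i | c i != c0 i] => //; rewrite inE.
  by apply/familyP => i; rewrite inE; case: eqVneq => [->|] //=; rewrite inE.
apply: (@leq_trans (\sum_(D : {set I} | #|D| <= rho) #|S| ^ rho)).
  elim/big_ind2: _ => [|A a B b Aa Bb|D Dr]; first by rewrite cards0.
    by apply: leq_trans (leq_card_setU _ _) _; exact: leq_add.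
  rewrite cardsE card_family.
  apply: (@leq_trans (\prod_(i : I) if i \in D then #|S| else 1)).
    rewrite foldrE big_map big_enum /=; apply: leq_prod => i _.
    by case: ifP => _; rewrite ?card1.
  by rewrite -big_mkcond prod_nat_const leq_pexp2l.
rewrite sum_nat_const leq_mul2r; apply/orP; right.
apply: leq_trans (max_card _) _.
by rewrite -cardsT -powersetT card_powerset cardsT.
Qed.

Local Open Scope ring_scope.

(** * Selecting columns of a matrix *)

(** The cofactors along column [i] do not see the column that replaces it, so Laplace expansion
    gives Cramer's rule. *)
Lemma cramer_colsub (F : fieldType) (r N : nat) (B : 'M[F]_(r, N))
    (f : {ffun 'I_r -> 'I_N}) (i : 'I_r) (q : 'I_N) :
  \det (colsub [ffun j => if j == i then q else f j] B) =
  \sum_l \adj (colsub f B) i l * B l q.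
Proof.
rewrite (expand_det_col _ i); apply: eq_bigr => l _.
rewrite !mxE ffunE eqxx mulrC; congr (_ * _).
rewrite /cofactor; congr (_ * \det _).
by apply/matrixP => a b; rewrite !mxE ffunE eq_sym (negPf (neq_lift _ _)).
Qed.

(* The columns are those of a maximal minor: by Cramer's rule the coordinates
   of the other columns are quotients of minors, hence at most 1. *)
Lemma bounded_column_selection (F : realFieldType) (m N : nat) (A : 'M[F]_(m, N)) :
  exists (B : 'M[F]_N) (S : {set 'I_N}),
    [/\ A *m B = A, (#|S| <= m)%N, forall i j, i \notin S -> B i j = 0
      & forall i j, `|B i j| <= m%:R].
Proof.
(* Since [A = col_base A *m Rb], linear relations among the columns of [Rb] carry over to [A], and
   [Rb] has a nonzero minor of full size. *)
pose r := \rank A; pose Rb := row_base A.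
have [f0 f0P] : exists f0 : {ffun 'I_r -> 'I_N}, \det (colsub f0 Rb) != 0.
  have full : row_full Rb^T by rewrite /row_full mxrank_tr; exact: row_base_free.
  exists (fullrankfun full).
  have := fullrowsub_unit full; rewrite unitmxE unitfE -det_tr.
  by congr (\det _ != 0); apply/matrixP => i j; rewrite !mxE.
pose f := [arg max_(f > f0) `|\det (colsub f Rb)| ]%O.
have fmax : forall h : {ffun 'I_r -> 'I_N},
    `|\det (colsub h Rb)| <= `|\det (colsub f Rb)|.
  by rewrite /f; case: arg_maxP => //= f1 _ Hf1 h; exact: Hf1.
have fne : \det (colsub f Rb) != 0.
  by rewrite -normr_gt0; apply: lt_le_trans (fmax f0); rewrite normr_gt0.
pose U := colsub f Rb.
have Uu : U \in unitmx by rewrite unitmxE unitfE.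
pose W := invmx U *m Rb.
have W1 : forall i q, `|W i q| <= 1.
  move=> i q; rewrite /W /invmx Uu -scalemxAl mxE mxE normrM normfV.
  rewrite mulrC ler_pdivrMr ?normr_gt0// mul1r -cramer_colsub; exact: fmax.
(* [W] holds the coordinates of every column in terms of the selected ones; [colsub f 1%:M] places
   them in the selected rows. *)
exists (colsub f 1%:M *m W), [set f i | i in 'I_r]; split.
- rewrite mulmxA; have -> : A *m colsub f 1%:M = col_base A *m U.
    by rewrite mulmx_colsub mulmx1 -[in LHS](mulmx_base A) mulmx_colsub.
  by rewrite /W mulmxA mulmxK// mulmx_base.
- by apply: leq_trans (leq_imset_card _ _) _; rewrite card_ord rank_leq_row.
- move=> i j iS; rewrite mxE big1 // => l _; rewrite !mxE.
  have [E|] := eqVneq i (f l); last by rewrite mul0r.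
  by rewrite E imset_f // in iS.
(* Bounding all [r] terms by 1 avoids proving [f] injective, at the price of [m] instead of 1. *)
- move=> i j; rewrite mxE; apply: le_trans (ler_norm_sum _ _ _) _.
  apply: (@le_trans _ _ (\sum_(l < r) 1)).
    apply: ler_sum => l _; rewrite normrM mulr_ile1 //.
    by rewrite !mxE; case: eqP => _; rewrite ?normr0 ?normr1.
  by rewrite sumr_const card_ord ler_nat rank_leq_row.
Qed.

(** * Transport *)

Section transport.
Context {R : realType} {D : nat}.
Implicit Types (x y : 'M[R]_D) (p q : @Defs.point D).

Definition unit_mass p : 'M[R]_D := delta_mx p.1 p.2.

(** Upper bounds on [emd] are kept as explicit plans of real cost, which can be added, scaled and
    summed. *)
Definition moves x y (c : R) : Prop :=
  exists2 g, transport x y g & transport_cost g <= c.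

Lemma unit_massE p q : unit_mass p q.1 q.2 = (q == p)%:R.
Proof. by rewrite mxE. Qed.

Lemma dist_ge0 p q : 0 <= dist p q :> R.
Proof. exact: sqrtr_ge0. Qed.

Lemma distxx p : dist p p = 0 :> R.
Proof. by rewrite /dist !subrr expr0n addr0 sqrtr0. Qed.

Lemma massE x : mass x = \sum_p x p.1 p.2.
Proof. by rewrite /mass pair_bigA. Qed.

Lemma moves_refl x : nonneg x -> moves x x 0.
Proof.
move=> x0; exists (fun a b => if a == b then x a.1 a.2 else 0).
  split=> [a b|a|b]; first by case: ifP.
    by rewrite -big_mkcond (big_pred1 a)// => b /=; rewrite eq_sym.
  rewrite (bigD1 b)//= eqxx big1 ?addr0// => a /negPf ->//.
rewrite /transport_cost big1 // => a _; rewrite big1 // => b _.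
by case: eqP => [->|_]; rewrite ?distxx ?mulr0 ?mul0r.
Qed.

Lemma moves_add x y x' y' c c' : moves x y c -> moves x' y' c' ->
  moves (x + x') (y + y') (c + c').
Proof.
move=> [g [g0 gx gy] gc] [h [h0 hx hy] hc].
exists (fun a b => g a b + h a b).
  split=> [a b|a|b]; first exact: addr_ge0.
    by rewrite big_split gx hx mxE.
  by rewrite big_split gy hy mxE.
rewrite /transport_cost.
rewrite (eq_bigr (fun a => \sum_b g a b * dist a b + \sum_b h a b * dist a b)).
  by rewrite big_split lerD.
by move=> a _; rewrite -big_split; apply: eq_bigr => b _; rewrite mulrDl.
Qed.

Lemma moves_scale x y c z : 0 <= z -> moves x y c -> moves (z *: x) (z *: y) (z * c).
Proof.
move=> z0 [g [g0 gx gy] gc]; exists (fun a b => z * g a b).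
  split=> [a b|a|b]; first exact: mulr_ge0.
    by rewrite -mulr_sumr gx mxE.
  by rewrite -mulr_sumr gy mxE.
rewrite /transport_cost (eq_bigr (fun a => z * \sum_b g a b * dist a b)).
  by rewrite -mulr_sumr ler_wpM2l.
by move=> a _; rewrite mulr_sumr; apply: eq_bigr => b _; rewrite mulrA.
Qed.

Lemma moves_le x y c c' : c <= c' -> moves x y c -> moves x y c'.
Proof. by move=> cc [g tg gc]; exists g => //; exact: le_trans cc. Qed.

Lemma moves_unit p q : moves (unit_mass p) (unit_mass q) (dist p q).
Proof.
exists (fun a b => (a == p)%:R * (b == q)%:R).
  split=> [a b|a|b]; first by rewrite mulr_ge0.
    rewrite unit_massE -mulr_sumr (bigD1 q)//= eqxx big1 ?addr0 ?mulr1//.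
    by move=> b /negPf ->.
  rewrite unit_massE -mulr_suml (bigD1 p)//= eqxx big1 ?addr0 ?mul1r//.
  by move=> a /negPf ->.
rewrite /transport_cost (bigD1 p)//= (bigD1 q)//= !eqxx !mul1r.
rewrite big1 ?addr0; last by move=> b /negPf ->; rewrite mulr0 mul0r.
rewrite big1 ?addr0// => a /negPf ->.
by rewrite big1 // => b _; rewrite !mul0r.
Qed.

Lemma moves_sum (I : finType) (x y : I -> 'M[R]_D) (c : I -> R) :
  (forall i, moves (x i) (y i) (c i)) ->
  moves (\sum_i x i) (\sum_i y i) (\sum_i c i).
Proof.
move=> H; elim/big_ind3: _ => //.
- by apply: moves_refl => i j; rewrite mxE.
- by move=> x1 x2 x3 y1 y2 y3; exact: moves_add.
Qed.

Lemma moves_mass x y c : moves x y c -> mass y = mass x.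
Proof.
move=> [g [_ gx gy] _]; rewrite !massE -(eq_bigr _ (fun p _ => gx p)).
by rewrite -(eq_bigr _ (fun p _ => gy p)) exchange_big.
Qed.

Lemma moves_emd x y c : moves x y c -> (emd x y <= c%:E)%E.
Proof.
move=> [g tg gc]; apply: le_trans (_ : _ <= (transport_cost g)%:E)%E _.
  by apply: ereal_inf_lbound; exists g.
by rewrite lee_fin.
Qed.

(** Each of the [D ^ 2] points sends a mass of at most [eps] to [p], over a distance crudely bounded
    by [2 * D]. *)
Lemma moves_noise (t : 'M[R]_D) (eps : R) p : nonneg t ->
  (forall i j, t i j <= eps) ->
  moves t (mass t *: unit_mass p) (D%:R ^+ 2 * (eps * (2 * D%:R))).
Proof.
move=> t0 te.
have tE : t = \sum_q t q.1 q.2 *: unit_mass q.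
  apply/matrixP => i j; rewrite summxE (bigD1 (i, j))//= mxE.
  rewrite (unit_massE (i, j) (i, j)) eqxx mulr1 big1 ?addr0// => q /negPf qij.
  by rewrite mxE (unit_massE q (i, j)) eq_sym qij mulr0.
have dist_le q : dist q p <= 2 * D%:R :> R.
  have sq (u v : 'I_D) : (u%:R - v%:R) ^+ 2 <= D%:R ^+ 2 :> R.
    have uD : u%:R <= D%:R :> R by rewrite ler_nat ltnW.
    have vD : v%:R <= D%:R :> R by rewrite ler_nat ltnW.
    have := ler0n R u; have := ler0n R v; nra.
  rewrite -[leRHS]ger0_norm ?mulr_ge0// -sqrtr_sqr; apply: ler_wsqrtr.
  have := sq q.1 p.1; have := sq q.2 p.2; have := sqr_ge0 (D%:R : R).
  rewrite exprMn; lra.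
have -> : mass t *: unit_mass p = \sum_q t q.1 q.2 *: unit_mass p.
  by rewrite massE scaler_suml.
rewrite {1}tE.
apply: moves_le (moves_sum (fun q => moves_scale (t0 q.1 q.2) (moves_unit q p))).
apply: (@le_trans _ _ (\sum_q eps * (2 * D%:R))).
  by apply: ler_sum => q _; apply: ler_pM => //; exact: dist_ge0.
by rewrite sumr_const card_prod card_ord -[_ *+ (D * D)]mulr_natl natrM expr2.
Qed.

Definition pairing (f : @Defs.point D -> R) x : R := \sum_p f p * x p.1 p.2.

Lemma pairingD f x y : pairing f (x + y) = pairing f x + pairing f y.
Proof.
by rewrite /pairing -big_split; apply: eq_bigr => p _; rewrite mxE mulrDr.
Qed.

Lemma pairingZ f z x : pairing f (z *: x) = z * pairing f x.
Proof.
by rewrite /pairing mulr_sumr; apply: eq_bigr => p _; rewrite mxE mulrCA.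
Qed.

Lemma pairing0 f : pairing f 0 = 0.
Proof. by rewrite /pairing big1// => p _; rewrite mxE mulr0. Qed.

Lemma pairing_sum (I : finType) f (x : I -> 'M[R]_D) :
  pairing f (\sum_i x i) = \sum_i pairing f (x i).
Proof.
by apply: (big_morph (pairing f)) => [x1 x2|]; rewrite ?pairingD ?pairing0.
Qed.

Lemma pairing_unit f p : pairing f (unit_mass p) = f p.
Proof.
rewrite /pairing (bigD1 p)//= unit_massE eqxx mulr1 big1 ?addr0// => q /negPf qp.
by rewrite unit_massE qp mulr0.
Qed.

Section lipschitz.
Variables (I : finType) (F : I -> @Defs.point D -> R) (L : R).
Hypothesis L0 : 0 < L.
Hypothesis F_lip : forall p q, \sum_i `|F i p - F i q| <= L * dist p q.

(** Easy half of Kantorovich duality, for a test function with values in l1: a plan [g] writes the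
    difference of pairings as the sum of [F i a - F i b] weighted by [g a b]. *)
Lemma pairing_lipschitz_cost x y g : transport x y g ->
  \sum_i `|pairing (F i) x - pairing (F i) y| <= L * transport_cost g.
Proof.
move=> [g0 gx gy].
have E i : pairing (F i) x - pairing (F i) y =
    \sum_a \sum_b g a b * (F i a - F i b).
  rewrite /pairing (eq_bigr (fun a => \sum_b F i a * g a b)); last first.
    by move=> a _; rewrite -mulr_sumr gx.
  rewrite [X in _ - X](eq_bigr (fun b => \sum_a F i b * g a b)); last first.
    by move=> b _; rewrite -mulr_sumr gy.
  rewrite [X in _ - X]exchange_big -sumrB; apply: eq_bigr => a _.
  by rewrite -sumrB; apply: eq_bigr => b _; ring.
apply: (@le_trans _ _ (\sum_i \sum_a \sum_b g a b * `|F i a - F i b|)).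
  apply: ler_sum => i _; rewrite E; apply: le_trans (ler_norm_sum _ _ _) _.
  apply: ler_sum => a _; apply: le_trans (ler_norm_sum _ _ _) _.
  by apply: ler_sum => b _; rewrite normrM ger0_norm.
rewrite exchange_big /transport_cost mulr_sumr; apply: ler_sum => a _.
rewrite exchange_big mulr_sumr; apply: ler_sum => b _.
by rewrite -mulr_sumr mulrCA ler_wpM2l.
Qed.

Lemma pairing_lipschitz_emd x y c : (emd x y <= c%:E)%E ->
  \sum_i `|pairing (F i) x - pairing (F i) y| <= L * c.
Proof.
move=> H; rewrite -ler_pdivrMl// -lee_fin; apply: le_trans H.
apply: le_ereal_inf_tmp => _ [g tg <-].
by rewrite lee_fin ler_pdivrMl//; exact: pairing_lipschitz_cost.
Qed.

(** [xhat] is within [K * e] of [x] because [y] competes in the minimum, and [x] is within [e] of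
    [y]. The triangle inequality is applied to the pairings rather than to [emd]. *)
Lemma good_output_pairing k (K e : R) x y xhat : 0 <= K ->
  good_output k K x xhat -> nonneg y -> sparse k y -> moves x y e ->
  \sum_i `|pairing (F i) xhat - pairing (F i) y| <= L * (K + 1) * e.
Proof.
move=> K0 Hg y0 yk xy.
have xy_le := moves_emd xy.
have Hx : (emd xhat x <= (K * e)%:E)%E.
  apply: le_trans Hg _; rewrite EFinM; apply: lee_wpmul2l; first by rewrite lee_fin.
  apply: le_trans xy_le; apply: ereal_inf_lbound; exists y => //.
  by split=> //; exact: moves_mass xy.
rewrite -mulrA mulrDl mul1r mulrDr.
apply: le_trans (lerD (pairing_lipschitz_emd Hx) (pairing_lipschitz_emd xy_le)).
by rewrite -big_split; apply: ler_sum => i _; exact: ler_distD.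
Qed.

End lipschitz.
End transport.

(** * Codewords *)

Section stars.
Context {R : realType} {D n s : nat}.
Notation point := (Defs.point (D := D)).
Variables (leaf : 'I_n -> 'I_s -> point) (ctr : 'I_n -> point).
Variable F : 'I_n * 'I_s -> point -> R.

Definition codeword : finType := {ffun 'I_n -> 'I_s}.
Implicit Types (c : codeword) (w : seq codeword).

(** The list of candidates decoded from an output [x] at scale [z]. The radius is half of [z * n],
    so that two candidates are at l1 distance at most [z * n]. *)
Definition consistent (z : R) (x : 'M[R]_D) : {set codeword} :=
  [set c : codeword | \sum_i `|pairing (F i) x - z * (c i.1 == i.2)%:R|
    <= z * n%:R / 2]%SET.

Lemma hamming_sum c c' :
  \sum_(i : 'I_n * 'I_s) `|(c i.1 == i.2)%:R - (c' i.1 == i.2)%:R : R| =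
  (2 * #|[set a | c a != c' a]%SET|)%:R.
Proof.
rewrite -(pair_bigA _ (fun a l => `|(c a == l)%:R - (c' a == l)%:R|))/=.
rewrite -sum1_card natrM natr_sum mulr_sumr [RHS]big_mkcond; apply: eq_bigr => a _.
rewrite inE; case: (eqVneq (c a) (c' a)) => [->|ne].
  by rewrite big1// => l _; rewrite subrr normr0.
rewrite (bigD1 (c a))//= eqxx (bigD1 (c' a)) /=; last by rewrite eq_sym.
rewrite eqxx (negPf ne) eq_sym (negPf ne) big1.
  by rewrite subr0 sub0r normrN normr1 addr0 mulr1.
by move=> l /andP[/negPf h1 /negPf h2]; rewrite eq_sym h1 eq_sym h2 subrr normr0.
Qed.

(** Two candidates differ in at most [n / 2] cells, as each disagreement costs [2 * z] in l1; so the
    list lies in a Hamming ball around any of its members. *)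
Lemma card_consistent z x : 0 < z -> (0 < s)%N ->
  (#|consistent z x| <= 2 ^ n * s ^ n./2)%N.
Proof.
move=> z0 s0.
have [->|[c0 c0P]] := set_0Vmem (consistent z x); first by rewrite cards0.
apply: (@leq_trans
  #|[set c : codeword | (#|[set a | c a != c0 a]| <= n./2)%N]%SET|); last first.
  have := @card_hamming_ball 'I_n 'I_s c0 n./2; rewrite !card_ord; exact.
apply/subset_leq_card/fintype.subsetP => c cP.
move: c0P cP; rewrite /consistent !inE => c0P cP.
have : z * (2 * #|[set a | c a != c0 a]%SET|)%:R <= z * n%:R.
  rewrite -hamming_sum mulr_sumr.
  apply: le_trans (_ : _ <= z * n%:R / 2 + z * n%:R / 2) _; last by lra.
  apply: le_trans (lerD cP c0P); rewrite -big_split; apply: ler_sum => i _ /=.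
  rewrite -{1}(gtr0_norm z0) -normrM mulrBr.
  rewrite (distrC (pairing _ _)); exact: ler_distD.
rewrite ler_pM2l// ler_nat; lia.
Qed.

Variables (ht : 'I_s -> R) (L : R).
Hypotheses (L0 : 0 < L) (ht0 : forall l, 0 < ht l).
Hypothesis dist_leaf : forall a l, dist (leaf a l) (ctr a) = ht l.
Hypothesis F_leaf : forall i a l,
  F i (leaf a l) = if i == (a, l) then ht l else 0.
Hypothesis F_ctr : forall i a, F i (ctr a) = 0.
Hypothesis F_lip : forall p q, \sum_i `|F i p - F i q| <= L * dist p q.

(** The mass is inverse to the height, so that moving a leaf to its center costs 1 and its pairing
    with its own test function is 1. *)
Definition word c : 'M[R]_D := \sum_a (ht (c a))^-1 *: unit_mass (leaf a (c a)).

Definition center_word c : 'M[R]_D :=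
  \sum_a (ht (c a))^-1 *: unit_mass (ctr a).

Variable (b : R).

(** Entry [i] has weight [b ^+ i]: the last codeword is the heaviest. *)
Definition nest (f : codeword -> 'M[R]_D) w : 'M[R]_D :=
  foldr (fun c x => f c + b *: x) 0 w.

Lemma nest_cat f w w' : nest f (w ++ w') = nest f w + b ^+ size w *: nest f w'.
Proof.
elim: w => [|c w IH] /=; first by rewrite expr0 scale1r add0r.
by rewrite IH scalerDr addrA scalerA -exprS.
Qed.

Lemma nest_rcons f w c : nest f (rcons w c) = nest f w + b ^+ size w *: f c.
Proof. by rewrite -cats1 nest_cat /= scaler0 addr0. Qed.

Hypothesis b1 : 1 < b.

Let b0 : 0 < b := lt_trans ltr01 b1.

Lemma unit_mass_ge0 p : nonneg (unit_mass p : 'M[R]_D).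
Proof. by move=> i j; rewrite mxE. Qed.

Lemma word_ge0 c : nonneg (word c).
Proof.
move=> i j; rewrite summxE; apply: sumr_ge0 => a _.
by rewrite mxE mulr_ge0 ?unit_mass_ge0// invr_ge0 ltW.
Qed.

Lemma nest_ge0 f w : (forall c, nonneg (f c)) -> nonneg (nest f w).
Proof.
move=> f0; elim: w => [|c w IH] i j /=; first by rewrite mxE.
by rewrite !mxE addr_ge0 ?f0// mulr_ge0// ltW.
Qed.

Lemma moves_word c : moves (word c) (center_word c) n%:R.
Proof.
rewrite -[n in n%:R]card_ord -sumr_const; apply: moves_sum => a.
have := moves_scale (ltW (_ : 0 < (ht (c a))^-1)) (moves_unit (leaf a (c a)) (ctr a)).
by rewrite dist_leaf mulVf ?gt_eqF// invr_gt0; exact.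
Qed.

Lemma moves_nest w : moves (nest word w) (nest center_word w)
  (n%:R * (b ^+ size w - 1) / (b - 1)).
Proof.
have bn0 : b - 1 != 0 by rewrite subr_eq0 gt_eqF.
elim: w => [|c w IH] /=.
  by rewrite expr0 subrr mulr0 mul0r; apply: moves_refl => i j; rewrite mxE.
have := moves_add (moves_word c) (moves_scale (ltW b0) IH).
by apply: moves_le; rewrite le_eqVlt; apply/orP; left; apply/eqP; rewrite exprS; field.
Qed.

Lemma pairing_word i c : pairing (F i) (word c) = (c i.1 == i.2)%:R.
Proof.
rewrite /word pairing_sum (bigD1 i.1)//= pairingZ pairing_unit F_leaf big1.
  case: i => a l /=; rewrite addr0 xpair_eqE eqxx/= eq_sym.
  by case: eqP => [->|]; rewrite ?mulr0// mulVf// gt_eqF.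
move=> a ai; rewrite pairingZ pairing_unit F_leaf.
by case: i ai => a' l /=; rewrite xpair_eqE eq_sym => /negPf ->; rewrite mulr0.
Qed.

Lemma pairing_nest_center i w : pairing (F i) (nest center_word w) = 0.
Proof.
elim: w => [|c w IH] /=; first by rewrite pairing0.
rewrite pairingD pairingZ IH mulr0 addr0 pairing_sum big1// => a _.
by rewrite pairingZ pairing_unit F_ctr mulr0.
Qed.

(** The top codeword dominates: a sparse vector that keeps it and collapses everything else onto the
    centers is so close to the input that any good output must be close to it. The value of [b]
    balances this error against the radius of [consistent]. *)
Lemma mem_consistent k (K eps : R) w c (t xhat : 'M[R]_D) :
  (0 < n)%N -> (n + n <= k)%N -> 0 <= K -> b - 1 = 2 * L * (K + 1) ->
  2 * D%:R ^+ 3 * eps * (b - 1) <= 1 ->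
  nonneg t -> (forall i j, t i j <= eps) ->
  good_output k K (nest word (rcons w c) + t) xhat ->
  c \in consistent (b ^+ size w) xhat.
Proof.
move=> n0 nk K0 bE epsE t0 te Hg.
pose a0 := Ordinal n0.
(* Supported on [n] leaves and [n] centers, whatever the number of lower levels; the test functions
   vanish at the centers, so only the top codeword is seen. *)
pose y : 'M[R]_D :=
  nest center_word w + b ^+ size w *: word c + mass t *: unit_mass (ctr a0).
have bn0 : b - 1 != 0 by rewrite subr_eq0 gt_eqF.
have bw0 : 0 < b ^+ size w by rewrite exprn_gt0.
have cw0 c' : nonneg (center_word c').
  move=> i j; rewrite summxE; apply: sumr_ge0 => a _.
  by rewrite mxE mulr_ge0 ?unit_mass_ge0// invr_ge0 ltW.
have mt0 : 0 <= mass t by rewrite massE; apply: sumr_ge0.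
have y0 : nonneg y.
  move=> i j; rewrite !mxE !addr_ge0//; first exact: nest_ge0.
    by rewrite mulr_ge0 ?word_ge0// ltW.
  by rewrite mulr_ge0// unit_mass_ge0.
have center_supp w' p : p \notin [set ctr a | a in 'I_n]%SET ->
    nest center_word w' p.1 p.2 = 0.
  move=> pc; elim: w' => [|c' w' IH]/=; rewrite !mxE//.
  rewrite IH mulr0 addr0 summxE big1// => a _.
  rewrite mxE unit_massE; case: eqP => [E|_]; last by rewrite mulr0.
  by move: pc; rewrite E imset_f.
have word_supp p : p \notin [set leaf a (c a) | a in 'I_n]%SET -> word c p.1 p.2 = 0.
  move=> pl; rewrite summxE big1// => a _.
  rewrite mxE unit_massE; case: eqP => [E|_]; last by rewrite mulr0.
  by move: pl; rewrite E imset_f.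
have yk : sparse k y.
  rewrite /sparse; apply: leq_trans nk.
  apply: (@leq_trans #|[set leaf a (c a) | a in 'I_n]%SET :|:
      [set ctr a | a in 'I_n]%SET|); last first.
    apply: leq_trans (leq_card_setU _ _) _.
    by apply: leq_add; apply: leq_trans (leq_imset_card _ _) _; rewrite card_ord.
  apply/subset_leq_card/fintype.subsetP => p; rewrite !inE; apply: contraR.
  rewrite negb_or => /andP[pl pc].
  have -> : y p.1 p.2 = nest center_word w p.1 p.2 + b ^+ size w * word c p.1 p.2 +
      mass t * unit_mass (ctr a0) p.1 p.2 by rewrite !mxE.
  have pc0 : p != ctr a0 by apply: contraNneq pc => ->; rewrite imset_f.
  by rewrite center_supp// word_supp// unit_massE (negPf pc0) !mulr0 !addr0.
pose e := n%:R * (b ^+ size w - 1) / (b - 1) + D%:R ^+ 2 * (eps * (2 * D%:R)).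
have xy : moves (nest word (rcons w c) + t) y e.
  rewrite nest_rcons /y /e; apply: moves_add (moves_noise _ t0 te).
  rewrite -[X in moves _ _ X]addr0; apply: moves_add; first exact: moves_nest.
  rewrite -(mulr0 (b ^+ size w)); apply: moves_scale; first exact: ltW.
  exact/moves_refl/word_ge0.
have H := good_output_pairing L0 F_lip K0 Hg y0 yk xy.
rewrite inE; apply: le_trans (_ : L * (K + 1) * e <= _).
  apply: le_trans H; apply: ler_sum => i _.
  rewrite /y !pairingD !pairingZ pairing_nest_center pairing_word pairing_unit F_ctr.
  by rewrite mulr0 add0r addr0.
have LK : L * (K + 1) = (b - 1) / 2 by rewrite bE; field.
have n1 : 1 <= n%:R :> R by rewrite ler1n.
have -> : L * (K + 1) * e =
    (n%:R * (b ^+ size w - 1) + 2 * D%:R ^+ 3 * eps * (b - 1)) / 2.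
  by rewrite LK /e; field.
(* The [- n] left by the geometric sum absorbs the noise term, which is at most 1. *)
rewrite ler_pM2r ?invr_gt0// mulrBr mulr1 (mulrC n%:R).
lra.
Qed.

End stars.

(** * The grid *)

Definition natdist (u v : nat) : nat := (u - v + (v - u))%N.

Lemma natdistC u v : natdist u v = natdist v u.
Proof. by rewrite /natdist addnC. Qed.

Lemma natdistE (R : realType) (u v : nat) : (natdist u v)%:R = `|u%:R - v%:R| :> R.
Proof.
rewrite /natdist; have [uv|/ltnW vu] := leqP u v.
  rewrite (eqP uv) add0n natrB// distrC ger0_norm// subr_ge0 ler_nat //.
by rewrite (eqP vu) addn0 natrB// ger0_norm// subr_ge0 ler_nat.
Qed.

Lemma natdist_dist (R : realType) (D : nat) (p q : Defs.point (D := D)) :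
  ((natdist p.1 q.1 + natdist p.2 q.2)%N)%:R <= 2 * dist p q :> R.
Proof.
rewrite natrD !natdistE.
have H (u v : R) : `|u| <= Num.sqrt (u ^+ 2 + v ^+ 2).
  by rewrite -sqrtr_sqr; apply: ler_wsqrtr; rewrite lerDl sqr_ge0.
have := H (p.1%:R - q.1%:R) (p.2%:R - q.2%:R).
have := H (p.2%:R - q.2%:R) (p.1%:R - q.1%:R).
by rewrite (addrC (_ ^+ 2)) /dist; lra.
Qed.

(** A pyramid of height [h] with apex at the leaf [(x + h, y)]; slope 2 makes it vanish from l1
    distance [h / 2] on, thanks to truncated subtraction. *)
Definition bump (x y h u v : nat) : nat :=
  (h - 2 * natdist u (x + h) - 2 * natdist v y)%N.

Lemma bump_lipschitz x y h u v u' v' :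
  (bump x y h u v <= bump x y h u' v' + 2 * (natdist u u' + natdist v v'))%N.
Proof. by rewrite /bump /natdist; lia. Qed.

(** Relative to its cell, a bump of height [3 ^ i] lives strictly between [3 ^ i / 2] and
    [3 ^ i.+1 / 2] in the first coordinate. Powers of 3 thus give disjoint supports, which stay near
    their own cell as [3 ^ i.+1 <= l]. *)
Lemma bump_disjoint (l s i i' a1 a1' a2 a2' u v : nat) : (3 ^ s <= l)%N ->
  (i < s)%N -> (i' < s)%N ->
  (0 < bump (a1 * l) (a2 * l) (3 ^ i) u v)%N ->
  (0 < bump (a1' * l) (a2' * l) (3 ^ i') u v)%N ->
  [/\ a1 = a1', a2 = a2' & i = i'].
Proof.
move=> sl.
wlog ii : i i' a1 a1' a2 a2' / (i <= i')%N => [H|].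
  have [ii|/ltnW ii] := leqP i i'; first exact: H.
  by move=> h1 h2 h3 h4; have [-> -> ->] := H _ _ _ _ _ _ ii h2 h1 h4 h3.
move=> i_s i'_s.
have cell a a' : (natdist (a * l) (a' * l) < l)%N -> a = a'.
  rewrite /natdist; case: (ltngtP a a') => // aa.
    have : (a.+1 * l <= a' * l)%N by rewrite leq_mul2r aa orbT.
    by rewrite mulSn; lia.
  have : (a'.+1 * l <= a * l)%N by rewrite leq_mul2r aa orbT.
  by rewrite mulSn; lia.
have i3 : (3 * 3 ^ i <= l)%N.
  by rewrite -expnS; apply: leq_trans sl; rewrite leq_exp2l.
have i'3 : (3 * 3 ^ i' <= l)%N.
  by rewrite -expnS; apply: leq_trans sl; rewrite leq_exp2l.
rewrite /bump => h h'.
have E1 : a1 = a1' by apply: cell; move: h h'; rewrite /natdist; lia.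
have E2 : a2 = a2' by apply: cell; move: h h'; rewrite /natdist; lia.
split=> //; subst; apply/eqP; rewrite eqn_leq ii/= leqNgt; apply/negP => ii'.
have : (3 * 3 ^ i <= 3 ^ i')%N by rewrite -expnS leq_exp2l.
by move: h h'; rewrite /natdist; lia.
Qed.

Section grid.
Context {R : realType} (D n s g l : nat).
Hypotheses (gl : (g * l <= D)%N) (sl : (3 ^ s <= l)%N) (ng : (n <= g * g)%N).
Notation point := (Defs.point (D := D)).

(** Cells are numbered row by row in a [g] by [g] array; the leaves of a star are aligned along the
    first coordinate, the only one with an offset. *)
Lemma cell_lt (a : 'I_n) (u : nat) : (u < l)%N ->
  (a %/ g * l + u < D)%N /\ (a %% g * l < D)%N.
Proof.
move=> ul.
have ag : (a < g * g)%N := leq_trans (ltn_ord a) ng.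
have g0 : (0 < g)%N by case: (g) ag.
have H (c : nat) : (c < g)%N -> (c * l + u < D)%N.
  move=> cg; apply: leq_trans gl; apply: (@leq_trans (c.+1 * l)).
    by rewrite mulSn addnC ltn_add2r.
  by rewrite leq_mul2r cg orbT.
split; first by apply: H; rewrite ltn_divLR.
by apply: leq_ltn_trans (H _ (ltn_pmod a g0)); rewrite leq_addr.
Qed.

Lemma leaf_lt (i : 'I_s) : (3 ^ i < l)%N.
Proof. by apply: leq_trans sl; rewrite ltn_exp2l. Qed.

Lemma l_gt0 : (0 < l)%N.
Proof. by apply: leq_trans sl; rewrite expn_gt0. Qed.

Definition grid_leaf (a : 'I_n) (i : 'I_s) : point :=
  (Ordinal (cell_lt a (leaf_lt i)).1, Ordinal (cell_lt a (leaf_lt i)).2).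

Definition grid_center (a : 'I_n) : point :=
  (Ordinal (cell_lt a l_gt0).1, Ordinal (cell_lt a l_gt0).2).

Definition grid_bump (k : 'I_n * 'I_s) (p : point) : nat :=
  bump (k.1 %/ g * l) (k.1 %% g * l) (3 ^ k.2) p.1 p.2.

Lemma grid_dist a i : dist (grid_leaf a i) (grid_center a) = (3 ^ i)%:R :> R.
Proof.
rewrite /dist /= subrr expr0n addr0 addn0 natrD addrAC subrr add0r sqrtr_sqr.
by rewrite ger0_norm.
Qed.

Lemma grid_bump_unique k k' p :
  (0 < grid_bump k p)%N -> (0 < grid_bump k' p)%N -> k = k'.
Proof.
move=> h h'; have [E1 E2 E3] := bump_disjoint sl (ltn_ord k.2) (ltn_ord k'.2) h h'.
case: k k' {h h'} E1 E2 E3 => a i [a' i'] /= E1 E2 /val_inj ->; congr (_, _).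
by apply/val_inj; rewrite /= (divn_eq a g) (divn_eq a' g) E1 E2.
Qed.

Lemma grid_bump_leaf k a i :
  (grid_bump k (grid_leaf a i))%:R = (if k == (a, i) then (3 ^ i)%:R else 0 : R).
Proof.
have E : grid_bump (a, i) (grid_leaf a i) = (3 ^ i)%N.
  by rewrite /grid_bump /bump /natdist /=; lia.
case: eqVneq => [->|ne]; first by rewrite E.
case: (posnP (grid_bump k (grid_leaf a i))) => [->//|h].
by move/eqP: ne; case; apply: grid_bump_unique h _; rewrite E expn_gt0.
Qed.

(** The first coordinate suffices: at a center it is a multiple of [l], at distance at least
    [3 ^ k.2] from that of the leaf, twice what the bump needs to vanish. *)
Lemma grid_bump_center k a : grid_bump k (grid_center a) = 0%N.
Proof.
case: (posnP (grid_bump k (grid_center a))) => // h.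
exfalso; move: h; rewrite /grid_bump /= /bump addn0.
have [E|ne] := eqVneq (k.1 %/ g)%N (a %/ g)%N.
  by rewrite E /natdist; lia.
have : (3 ^ k.2 < l)%N := leaf_lt _.
have : (3 * 3 ^ k.2 <= l)%N by rewrite -expnS; apply: leq_trans sl; rewrite leq_exp2l.
move: ne; case: (ltngtP (k.1 %/ g)%N (a %/ g)%N) => // lt _.
  have : ((k.1 %/ g).+1 * l <= a %/ g * l)%N by rewrite leq_mul2r lt orbT.
  by rewrite mulSn /natdist; lia.
have : ((a %/ g).+1 * l <= k.1 %/ g * l)%N by rewrite leq_mul2r lt orbT.
by rewrite mulSn /natdist; lia.
Qed.

(** A bump is 4-Lipschitz (slope 2 in l1, and l1 is at most twice the Euclidean distance). At most
    one bump is nonzero at each of [p] and [q], so at most two terms count. *)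
Lemma grid_bump_lipschitz p q :
  \sum_k `|(grid_bump k p)%:R - (grid_bump k q)%:R| <= 8 * dist p q :> R.
Proof.
pose dl : R := 4 * dist p q.
have dl0 : 0 <= dl by rewrite mulr_ge0// dist_ge0.
have one (r : point) : \sum_k (0 < grid_bump k r)%N%:R <= 1 :> R.
  have [k kr|none] := pickP (fun k => (0 < grid_bump k r)%N).
    rewrite (bigD1 k)//= kr big1 ?addr0// => k' kk'.
    case: (posnP (grid_bump k' r)) => [//|h].
    by move: kk'; rewrite (grid_bump_unique h kr) eqxx.
  by rewrite big1// => k _; rewrite none.
have lip k : `|(grid_bump k p)%:R - (grid_bump k q)%:R| <= dl.
  have D2 := natdist_dist R p q.
  have := bump_lipschitz (k.1 %/ g * l)%N (k.1 %% g * l)%N (3 ^ k.2)%N p.1 p.2 q.1 q.2.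
  have := bump_lipschitz (k.1 %/ g * l)%N (k.1 %% g * l)%N (3 ^ k.2)%N q.1 q.2 p.1 p.2.
  rewrite -/(grid_bump k p) -/(grid_bump k q).
  rewrite (natdistC q.1) (natdistC q.2) -!(ler_nat R) (natrD _ (grid_bump k p)).
  rewrite (natrD _ (grid_bump k q)) natrM => h1 h2.
  by rewrite ler_norml /dl; apply/andP; split; lra.
apply: (@le_trans _ _
  (\sum_k ((0 < grid_bump k p)%N%:R + (0 < grid_bump k q)%N%:R) * dl)).
  apply: ler_sum => k _.
  case: (posnP (grid_bump k p)) => [hp|hp]; case: (posnP (grid_bump k q)) => [hq|hq].
  - by rewrite hp hq subrr normr0 addr0 mul0r.
  - by rewrite add0r mul1r.
  - by rewrite addr0 mul1r.
  - by apply: le_trans (lip k) _; rewrite mulrDl mul1r lerDl.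
rewrite -mulr_suml big_split/=.
have := one p; have := one q; rewrite /dl.
have := dist_ge0 p q (R := R); nra.
Qed.

End grid.

(** * Lebesgue measure on tuples *)

Local Open Scope classical_set_scope.
Local Open Scope ring_scope.

Definition box (R : realType) (n : nat) (lo hi : 'I_n -> R) : set (n.-tuple R) :=
  [set t | forall i, lo i <= tnth t i <= hi i].

Definition translate (R : realType) (n : nat) (b : 'I_n -> R) (t : n.-tuple R) :
  n.-tuple R := [tuple tnth t i + b i | i < n].

(** The translated measure agrees with Lebesgue measure on half-open intervals, which determine
    it. *)
Lemma lebesgue_measureD (R : realType) (b : R) (E : set (measurableTypeR R)) :
  measurable E ->
  lebesgue_measure ((fun x : measurableTypeR R => x + b : measurableTypeR R) @^-1` E) =
  lebesgue_measure E.
Proof.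
move=> mE.
have mf : measurable_fun setT (fun x : measurableTypeR R => x + b : measurableTypeR R).
  exact: measurable_funD.
rewrite (_ : _ (_ @^-1` _) = pushforward lebesgue_measure
  (fun x : measurableTypeR R => x + b : measurableTypeR R) E) //.
apply/esym; apply: lebesgue_measure_unique => // _ [[u v]] _ <-.
have E' : (fun x : measurableTypeR R => x + b : measurableTypeR R) @^-1`
    [set` `]u, v]] = [set` `]u - b, v - b]].
  by apply/seteqP; split=> x /=; rewrite !in_itv/= ltrBlDr lerBrDr.
rewrite [RHS](_ : _ = lebesgue_measure `]u - b, v - b]%classic); last by rewrite -E'.
rewrite !lebesgue_measure_itv/= !lte_fin ltrD2r.
by case: ifP => // _; rewrite -!EFinD; congr (_%:E); ring.
Qed.

Lemma measurable_box (R : realType) (n : nat) (lo hi : 'I_n -> R) :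
  measurable (box lo hi).
Proof.
have -> : box lo hi = \bigcap_(i in [set: 'I_n])
   ((fun t : n.-tuple R => tnth t i) @^-1` [set` `[lo i, hi i]]).
  apply/seteqP; split=> t /=.
    by move=> H i _ /=; rewrite in_itv/=.
  by move=> H i; have := H i I; rewrite /= in_itv.
apply: fin_bigcap_measurable; first exact: finite_finset.
move=> i _; rewrite -[X in measurable X]setTI.
by apply: measurable_tnth => //; exact: measurable_itv.
Qed.

Lemma measurable_translate (R : realType) (n : nat) (b : 'I_n -> R) :
  measurable_fun setT (translate b).
Proof.
apply/measurable_fun_tnthP => i.
rewrite (_ : _ \o _ = fun t : n.-tuple R => tnth t i + b i); last first.
  by apply/funext => t /=; rewrite tnth_mktuple.
by apply: measurable_funD => //; exact: measurable_tnth.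
Qed.

(** The cubes of side [2 * k] around 0 exhaust the space. Sigma-finiteness is what allows the next
    product to be formed and sections to be integrated. *)
Lemma sigma_finite_box_measure (R : realType) (n : nat)
    (mu : {measure set (n.-tuple R) -> \bar R}) :
  (forall lo hi : 'I_n -> R, (forall i, lo i <= hi i) ->
    mu (box lo hi) = (\prod_i (hi i - lo i))%:E) ->
  sigma_finite setT mu.
Proof.
move=> Hbox.
exists (fun k : nat => box (fun _ : 'I_n => - k%:R) (fun=> k%:R)); last first.
  move=> k; split; first exact: measurable_box.
  rewrite Hbox ?ltry// => _; rewrite -subr_ge0 opprK; apply: addr_ge0; exact: ler0n.
apply/seteqP; split=> // t _.
have [k hk] : exists k : nat, forall i, `|tnth t i| <= k%:R.
  exists (\max_i (Num.truncn `|tnth t i|).+1)%N => i.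
  apply: (@le_trans _ _ (Num.truncn `|tnth t i|).+1%:R).
    by apply: ltW; rewrite -truncn_le_nat //.
  by rewrite ler_nat; exact: (leq_bigmax i).
by exists k => // i; rewrite -ler_norml.
Qed.

Section sigma_finite_measure_of.
Context d (T : measurableType d) (R : realType).
Variables (mu : {measure set T -> \bar R}) (sf : sigma_finite setT mu).

(* The proof is an argument so that instances can be attached to this name. *)
Definition sigma_finite_measure_of (_ : sigma_finite setT mu) : set T -> \bar R := mu.

HB.instance Definition _ := Measure.on (sigma_finite_measure_of sf).

HB.instance Definition _ :=
  Measure_isSigmaFinite.Build _ _ _ (sigma_finite_measure_of sf) sf.

End sigma_finite_measure_of.

Lemma sigma_finite_measure_pack d (T : measurableType d) (R : realType)
    (mu : {measure set T -> \bar R}) : sigma_finite setT mu ->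
  exists mus : {sigma_finite_measure set T -> \bar R}, forall A, mus A = mu A.
Proof. by move=> sf; exists (sigma_finite_measure_of sf). Qed.

(** By induction, as the image under cons of the product with one-dimensional Lebesgue measure; the
    Dirac mass at the empty tuple starts it. *)
Lemma tuple_lebesgue_exists (R : realType) (n : nat) :
  exists mu : {sigma_finite_measure set (n.-tuple R) -> \bar R},
  (forall lo hi : 'I_n -> R, (forall i, lo i <= hi i) ->
    mu (box lo hi) = (\prod_i (hi i - lo i))%:E) /\
  (forall (b : 'I_n -> R) (E : set (n.-tuple R)), measurable E ->
    mu (translate b @^-1` E) = mu E).
Proof.
elim: n => [|n [mu [muB muT]]].
  have Hbox : forall lo hi : 'I_0 -> R, (forall i, lo i <= hi i) ->
     dirac ([tuple] : 0.-tuple R) (box lo hi) = (\prod_i (hi i - lo i))%:E.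
    move=> lo hi _; rewrite big_ord0 diracE mem_set//; last by case.
  pose mu0 : {measure set (0.-tuple R) -> \bar R} := dirac ([tuple] : 0.-tuple R).
  have [mus musE] := sigma_finite_measure_pack (@sigma_finite_box_measure R 0 mu0 Hbox).
  exists mus; split=> [lo hi h|b E mE]; rewrite !musE; first exact: Hbox.
  congr (mu0 _).
  by apply/seteqP; split=> t; rewrite /preimage/= (tuple0 t) (tuple0 (translate _ _)).
pose c := fun p : measurableTypeR R * n.-tuple R => [the n.+1.-tuple R of p.1 :: p.2].
have mc : measurable_fun setT c by apply: measurable_cons.
pose mu1_of : {measure set (n.+1.-tuple R) -> \bar R} :=
  pushforward (lebesgue_measure \x mu)%E c.
pose mu1 := mu1_of mc.
have Hbox : forall lo hi : 'I_n.+1 -> R, (forall i, lo i <= hi i) ->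
    mu1 (box lo hi) = (\prod_i (hi i - lo i))%:E.
  move=> lo hi lohi.
  have E : c @^-1` box lo hi =
      `[lo ord0, hi ord0]%classic `*`
      box (fun i => lo (lift ord0 i)) (fun i => hi (lift ord0 i)).
    apply/seteqP; split => -[x t] /=.
      move=> H; split; first by have := H ord0; rewrite /c/= /tnth/= in_itv.
      by move=> i; have := H (lift ord0 i); rewrite tnthS.
    move=> [Hx Ht] i; have [j ->|->] := unliftP ord0 i.
      by rewrite tnthS; exact: Ht.
    by move: Hx; rewrite in_itv.
  rewrite /mu1/mu1_of/= /measure_function.pushforward E product_measure1E//;
    last exact: measurable_box.
  rewrite big_ord_recl EFinM; congr (_ * _)%E; last exact: muB.
  have L : lebesgue_measure `[lo ord0, hi ord0]%classic = (hi ord0 - lo ord0)%:E.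
    rewrite lebesgue_measure_itv/= lte_fin.
    case: ltP => // h; have -> : lo ord0 = hi ord0 by apply/eqP; rewrite eq_le lohi h.
    by rewrite subrr.
  exact: L.
have [mus musE] :=
  sigma_finite_measure_pack (@sigma_finite_box_measure R n.+1 mu1 Hbox).
exists mus; split=> [lo hi h|b E mE]; rewrite !musE; first exact: Hbox.
rewrite /mu1/mu1_of/= /measure_function.pushforward.
pose b' : 'I_n -> R := fun i => b (lift ord0 i).
have mcE : measurable (c @^-1` E).
  by rewrite -[X in measurable X]setTI; exact (mc measurableT _ mE).
pose sh := fun x : measurableTypeR R => (x + b ord0 : measurableTypeR R).
have msh : measurable_fun setT sh by exact: measurable_funD.
pose phi := fun x : measurableTypeR R => mu (xsection (c @^-1` E) x).
have mphi : measurable_fun setT phi by exact: measurable_fun_xsection.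
have shE (x : measurableTypeR R) (t : n.-tuple R) :
    translate b (c (x, t)) = c (sh x, translate b' t).
  apply: eq_from_tnth => i; have [j ->|->] := unliftP ord0 i.
    by rewrite !(tnthS, tnth_mktuple).
  by rewrite tnth_mktuple.
(* The measure is the integral of the measures of the sections: the induction hypothesis translates
   inside a section, the one-dimensional case moves the sections. *)
transitivity (\int[lebesgue_measure]_(x in sh @^-1` setT) (phi \o sh) x)%E.
  rewrite preimage_setT; apply: eq_integral => x _ /=.
  rewrite /phi -[RHS](muT b'); last exact: measurable_xsection.
  congr (mu _); apply/seteqP.
  by split=> t; rewrite /xsection/=/preimage/= !inE/= shE.
rewrite -(ge0_integral_pushforward msh) //.
apply: eq_measure_integral => A mA _.
exact: lebesgue_measureD.
Qed.

Lemma integral_sum_indic d (T : measurableType d) (R : realType)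
    (mu : {measure set T -> \bar R}) (I : finType) (a : I -> R) (E : I -> set T) :
  (forall i, 0 <= a i) -> (forall i, measurable (E i)) ->
  (\int[mu]_x (\sum_i a i * \1_(E i) x)%:E = \sum_i (a i)%:E * mu (E i))%E.
Proof.
move=> a0 mE.
under eq_integral do rewrite -sumEFin.
rewrite ge0_integral_sum //.
- apply: eq_bigr => i _; under eq_integral do rewrite EFinM.
  rewrite ge0_integralZl //; last by rewrite lee_fin.
  + by rewrite integral_indic// setIT.
  + exact/measurable_EFinP/measurable_indic.
- move=> i; apply/measurable_EFinP; apply: measurable_funM => //.
- by move=> i x _; rewrite lee_fin mulr_ge0.
Qed.

(** Turns a count made point by point into an inequality of measures; it serves both for the overlap
    of translates and for the charging of levels. *)
Lemma le_sum_measure d (T : measurableType d) (R : realType)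
    (mu : {measure set T -> \bar R}) (I J : finType) (a : I -> R) (b : J -> R)
    (E : I -> set T) (F : J -> set T) :
  (forall i, 0 <= a i) -> (forall j, 0 <= b j) ->
  (forall i, measurable (E i)) -> (forall j, measurable (F j)) ->
  (forall x, \sum_i a i * \1_(E i) x <= \sum_j b j * \1_(F j) x :> R) ->
  (\sum_i (a i)%:E * mu (E i) <= \sum_j (b j)%:E * mu (F j))%E.
Proof.
move=> a0 b0 mE mF EF; rewrite -!integral_sum_indic//.
have ms (K : finType) (c : K -> R) (G : K -> set T) : (forall k, measurable (G k)) ->
    measurable_fun setT (fun x => (\sum_k c k * \1_(G k) x)%:E).
  move=> mG; apply/measurable_EFinP; apply: measurable_sum => k.
  exact: measurable_funM.
apply: ge0_le_integral => //; try exact: ms; move=> x _; rewrite lee_fin//.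
by apply: sumr_ge0 => i _; rewrite mulr_ge0.
Qed.

(** Averaging by Tonelli, which rests on the joint measurability of each [S i]: otherwise the mean
    over [w] would be at least [c] and at most [c'] times [#|I| * q]. The gap [c' < c] makes
    non-strict bounds enough under the integral. *)
Lemma exists_good_outcome d d' (T : measurableType d) (U : measurableType d')
    (R : realType) (P : probability T R) (mu : {sigma_finite_measure set U -> \bar R})
    (Q : set U) (I : finType) (S : I -> set (T * U)) (c c' q : R) :
  measurable Q -> mu Q = q%:E -> 0 < q -> 0 <= c' -> c' < c -> (0 < #|I|)%N ->
  (forall i, measurable (S i)) ->
  (forall i t, Q t -> (c%:E <= P (ysection (S i) t))%E) ->
  exists w, ((c' * #|I|%:R * q)%:E <= \sum_i mu (Q `&` xsection (S i) w))%E.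
Proof.
move=> mQ muQ q0 c'0 c'c I0 mS PS; apply: contrapT => /forallNP H.
have {}H w : (\sum_i mu (Q `&` xsection (S i) w) <= (c' * #|I|%:R * q)%:E)%E.
  by apply: ltW; rewrite ltNge; apply/negP; exact: H.
pose S' i := S i `&` (setT `*` Q).
have mS' i : measurable (S' i) by apply: measurableI => //; exact: measurableX.
have xS' i w : Q `&` xsection (S i) w = xsection (S' i) w.
  apply/seteqP; split=> t; rewrite /xsection/= !inE/=.
    by move=> [? ?]; split.
  by move=> [? []].
have E : (\int[P]_w \sum_i mu (Q `&` xsection (S i) w) =
          \sum_i \int[mu]_t P (ysection (S' i) t))%E.
  rewrite ge0_integral_sum //.
    apply: eq_bigr => i _; under eq_integral do rewrite xS'.
    have := indic_fubini_tonelli P mu (mS' i).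
    by rewrite indic_fubini_tonelli_FE// indic_fubini_tonelli_GE.
  move=> i; rewrite (_ : (fun w => _) = mu \o xsection (S' i)).
    exact: measurable_fun_xsection.
  by apply/funext => w /=; rewrite xS'.
have E1 : (\int[P]_w \sum_i mu (Q `&` xsection (S i) w) <= (c' * #|I|%:R * q)%:E)%E.
  apply: (@le_trans _ _ (\int[P]_w (c' * #|I|%:R * q)%:E)%E).
    apply: ge0_le_integral => //; first by move=> w _; exact: sume_ge0.
      apply: emeasurable_sum => i.
      rewrite (_ : (fun w => _) = mu \o xsection (S' i)).
        exact: measurable_fun_xsection.
      by apply/funext => w /=; rewrite xS'.
  rewrite integral_cst//.
  by rewrite [X in (_ * X)%E]probability_setT mule1.
have E2 : ((c * #|I|%:R * q)%:E <= \sum_i \int[mu]_t P (ysection (S' i) t))%E.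
  apply: (@le_trans _ _ (\sum_(i in I) (c * q)%:E)%E).
    by rewrite sumEFin sumr_const lee_fin -mulr_natr; lra.
  apply: lee_sum => i _.
  apply: (@le_trans _ _ (\int[mu]_(t in Q) c%:E)%E).
    by rewrite integral_cst// [X in (_ * X)%E]muQ -EFinM.
  rewrite integral_mkcond; apply: ge0_le_integral => //.
  - by move=> t _; rewrite patchE; case: ifP => // _; rewrite lee_fin; lra.
  - by apply/(measurable_restrictT _ mQ) .
  - exact: (measurable_fun_ysection P (mS' i)).
  move=> t _; rewrite patchE; case: ifPn => [|_]; last exact: measure_ge0.
  rewrite inE => Qt.
  rewrite (_ : ysection (S' i) t = ysection (S i) t); first exact: PS.
  apply/seteqP; split=> w; rewrite /ysection/= !inE/=; first by case.
  by split.
have := le_trans E2 (le_trans _ E1); rewrite -E lexx lee_fin => /(_ isT).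
rewrite -!mulrA ler_pM2r; first by rewrite leNgt c'c.
by rewrite mulr_gt0// ltr0n.
Qed.

(** * The packing argument *)

Definition col_of_tuple (R : realType) (n : nat) (t : n.-tuple R) : 'cV[R]_n :=
  \col_l tnth t l.

(** By Bernoulli's inequality, powers of a number above 1 are unbounded. *)
Lemma expr_bounded_le1 (R : realType) (x c : R) :
  0 <= x -> (forall n : nat, (0 < n)%N -> x ^+ n <= c) -> x <= 1.
Proof.
move=> x0 H; rewrite leNgt; apply/negP => x1.
have B n : 1 + (x - 1) * n%:R <= x ^+ n.
  elim: n => [|n IH]; first by rewrite mulr0 addr0 expr0.
  rewrite exprS -natr1.
  apply: (@le_trans _ _ (x * (1 + (x - 1) * n%:R))); last by rewrite ler_wpM2l.
  have : 0 <= (x - 1) ^+ 2 * n%:R by rewrite mulr_ge0 ?sqr_ge0.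
  rewrite expr2; nra.
have := B (Num.truncn (c / (x - 1))).+1; have := H (Num.truncn (c / (x - 1))).+1 isT.
have := truncnS_gt (c / (x - 1)); rewrite ltr_pdivrMr ?subr_gt0//.
lra.
Qed.

(** [V] counts tuples, [q] is the volume of the cube, [K] counts sets of levels and [L] bounds one
    packing. The left side is [5/4 * J * V * q], so a quarter of [J * V * q] survives. *)
Lemma success_arith (R : realFieldType) (J V q K L : R) : 0 < J ->
  5 / 8 * (V * (J + J)) * q <= J * (V * q) + K * ((J + J) * L) ->
  V * q <= 8 * (K * L).
Proof.
move=> J0 H; rewrite -(ler_pM2l J0); lra.
Qed.

(** Isolates what grows with [J]: the 4 comes from the [2 ^+ (J + J)] sets of levels, [b ^+ (2 * m)]
    from the [m] long sides of the slab, and [c] does not depend on [J]. *)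
Lemma growth_arith (R : realFieldType) (M b bt r eps c kap : R) (J m : nat) :
  0 < M -> 1 <= b -> 0 < bt -> 0 < eps -> 0 <= kap ->
  r = eps + kap * b ^+ (J + J) -> c = 2 * (eps + kap) / eps ->
  M ^+ (J + J) <= 8 * (2 ^+ (J + J) * ((bt * M) ^+ J * (2 * r / eps) ^+ m)) ->
  (M / (4 * bt * b ^+ (2 * m))) ^+ J <= 8 * c ^+ m.
Proof.
move=> M0 b1 bt0 eps0 kap0 rE cE H.
have b0 : 0 < b by exact: lt_le_trans b1.
have c0 : 0 <= c by rewrite cE divr_ge0 ?mulr_ge0 ?addr_ge0 // ltW.
have B1 : 1 <= b ^+ (J + J) by exact: exprn_ege1.
have rc : 2 * r / eps <= c * b ^+ (J + J).
  rewrite cE [leRHS]mulrAC ler_pM2r ?invr_gt0// rE -mulrA ler_pM2l//.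
  rewrite mulrDl lerD2r; nra.
have r0 : 0 <= 2 * r / eps.
  by rewrite rE divr_ge0 ?mulr_ge0 ?addr_ge0 ?mulr_ge0 ?exprn_ge0// ltW.
rewrite expr_div_n ler_pdivrMr; last by rewrite exprn_gt0 ?mulr_gt0 ?exprn_gt0.
rewrite -(ler_pM2l (exprn_gt0 J M0)) -exprD; apply: le_trans H _.
have -> : M ^+ J * (8 * c ^+ m * (4 * bt * b ^+ (2 * m)) ^+ J) =
  8 * (2 ^+ (J + J) * ((bt * M) ^+ J * (c * b ^+ (J + J)) ^+ m)).
  have e4 : 4 ^+ J = 2 ^+ (J + J) :> R.
    by rewrite exprD -exprMn; congr (_ ^+ _); ring.
  have em : (2 * m * J = (J + J) * m)%N by lia.
  by rewrite !exprMn e4 -!exprM em; ring.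
do 2 (rewrite ler_pM2l; last by rewrite ?exprn_gt0).
rewrite ler_pM2l; last by rewrite exprn_gt0 ?mulr_gt0.
by apply: lerXn2r => //; rewrite nnegrE // mulr_ge0 // exprn_ge0 // ltW.
Qed.

Section nested_packing.
Context (R : realType) d (T : measurableType d) (P : probability T R).
Variables (N m : nat) (A : T -> 'M[R]_(m, N)) (C : finType).
Variables (X : seq C -> 'cV[R]_N) (good : T -> 'cV[R]_N -> Prop).
Variables (b kappa eps : R) (beta : nat).
Hypotheses (eps0 : 0 < eps) (b1 : 1 <= b) (kappa0 : 0 <= kappa).
Hypotheses (beta0 : (0 < beta)%N) (beta_le : (beta <= #|C|)%N).
Hypothesis X_cat : forall s1 s2, X (s1 ++ s2) = X s1 + b ^+ size s1 *: X s2.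
Hypothesis X_bound : forall s l, `|X s l 0| <= kappa * b ^+ size s.
Let Q : set (N.-tuple R) := box (fun=> 0) (fun=> eps).
Hypothesis good_measurable : forall s,
  measurable [set p : T * N.-tuple R | good p.1 (X s + col_of_tuple p.2)].
Hypothesis good_likely : forall s t, Q t ->
  ((3 / 4)%:E <= P [set w | good w (X s + col_of_tuple t)])%E.
Hypothesis good_decode : forall w i (y : 'cV[R]_m), exists Z : {set C},
  (#|Z| <= beta)%N /\
  forall s c t, size s = i -> Q t ->
    good w (X (rcons s c) + col_of_tuple t) ->
    A w *m (X (rcons s c) + col_of_tuple t) = y -> c \in Z.

(** Level [i] is tested on the prefix of [v] whose top symbol is entry [i], as if the higher entries
    had been subtracted. *)
Let level (w : T) J (v : J.-tuple C) (i : 'I_J) : set (N.-tuple R) :=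
  Q `&` [set t | good w (X (take i.+1 v) + col_of_tuple t)].

Let measurable_level w J (v : J.-tuple C) i : measurable (level w v i).
Proof.
apply: measurableI; first exact: measurable_box.
have := measurable_xsection w (good_measurable (take i.+1 v)).
by congr (measurable _); apply/seteqP; split=> t; rewrite /xsection/= inE.
Qed.

Let levels (w : T) J (v : J.-tuple C) (I : {set 'I_J}) : set (N.-tuple R) :=
  Q `&` [set t | forall i, i \in I -> level w v i t].

Let measurable_levels w J (v : J.-tuple C) I : measurable (levels w v I).
Proof.
apply: measurableI; first exact: measurable_box.
rewrite (_ : [set t | _] = \bigcap_(i in [set i | i \in I]) level w v i).
  by apply: fin_bigcap_measurable => //; exact: finite_finset.
by apply/seteqP; split=> t H i /H.
Qed.

(* A tuple that is decoded on all levels in I is determined, from the top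
   level down, by the measurement and by one symbol per level: the lower
   levels and the noise are decoded once the higher ones are subtracted. *)
Let overlap w J (I : {set 'I_J}) (y : 'cV[R]_m) :
  (#|[set v : J.-tuple C | `[< exists2 t, levels w v I t &
       A w *m (X v + col_of_tuple t) = y >]]| <=
    \prod_(i < J) (if i \in I then beta else #|C|))%N.
Proof.
(* Subtracting from [y] the share of the entries [s] above [i] leaves the measurement of the
   truncated input, to which [good_decode] applies. Levels outside [I] are unconstrained. *)
pose Z i s : {set C} := if [exists j in I, val j == i] then
   sval (cid (good_decode w i (y - b ^+ i.+1 *: (A w *m X s)))) else [set: C]%SET.
pose bt i := if [exists j in I, val j == i] then beta else #|C|.
have inI (i : 'I_J) : [exists j in I, val j == i] = (i \in I).
  apply/existsP/idP => [[j /andP[jI /eqP/val_inj <-]] //|iI].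
  by exists i; rewrite iI eqxx.
rewrite (eq_bigr (fun i : 'I_J => bt i)); last by move=> i _; rewrite /bt inI.
apply: leq_trans (@card_guided_tuples C J Z bt _); last first.
  move=> i s; rewrite /Z /bt; case: ifP => _; last by rewrite cardsT.
  by case: cid => ? [].
apply/subset_leq_card/fintype.subsetP => v; rewrite !inE => /asboolP[t [Qt tI] tE].
apply/forallP => i; rewrite /Z inI; case: ifP => // iI.
case: cid => /= Zi [_ HZi].
have [_ gi] := tI i iI.
have TE : take i.+1 v = rcons (take i v) (tnth v i).
  by rewrite (tnth_nth (tnth v i)) -take_nth // size_tuple.
apply: (HZi (take i v) (tnth v i) t) => //; rewrite -?TE //.
  by rewrite size_takel // size_tuple ltnW.
have XE : X v = X (take i.+1 v) + b ^+ i.+1 *: X (drop i.+1 v).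
  by rewrite -[in LHS](cat_take_drop i.+1 v) X_cat size_takel // size_tuple.
by rewrite -tE XE !mulmxDr -scalemxAr (addrAC _ (_ *: _)) addrK.
Qed.

Section with_measure.
Variable mu : {sigma_finite_measure set (N.-tuple R) -> \bar R}.
Hypothesis mu_box : forall lo hi : 'I_N -> R, (forall i, lo i <= hi i) ->
  mu (box lo hi) = (\prod_i (hi i - lo i))%:E.
Hypothesis mu_translate : forall (u : 'I_N -> R) (E : set (N.-tuple R)),
  measurable E -> mu (translate u @^-1` E) = mu E.

Let slab (S : {set 'I_N}) (r : R) : set (N.-tuple R) :=
  box (fun l => if l \in S then - r else 0) (fun l => if l \in S then r else eps).

(** Each of the at most [m] long sides gains a factor [2 * r / eps] over the cube; as this factor is
    at least 1, the exponent may be raised to [m]. *)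
Let slab_measure (S : {set 'I_N}) (r : R) : (#|S| <= m)%N -> eps <= r ->
  (mu (slab S r) <= ((2 * r / eps) ^+ m * eps ^+ N)%:E)%E.
Proof.
move=> Sm er.
have r0 : 0 < r := lt_le_trans eps0 er.
rewrite mu_box; last first.
  move=> l /=; case: ifP => _; last exact: ltW.
  by rewrite (le_trans _ (ltW r0))// oppr_le0 ltW.
rewrite lee_fin.
rewrite (eq_bigr (fun l => (if l \in S then 2 * r / eps else 1) * eps)); last first.
  move=> l _; case: ifP => _; last by rewrite mul1r subr0.
  by rewrite divfK ?gt_eqF//; ring.
rewrite big_split/= prodr_const card_ord.
apply: ler_wpM2r; first by rewrite exprn_ge0 ?ltW.
rewrite -big_mkcond prodr_const.
apply: ler_weXn2l => //; rewrite ler_pdivlMr // mul1r.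
by rewrite (le_trans er)// mulrDl mul1r lerDl ltW.
Qed.

(** A coordinate of [B *m X v] has [N] terms, each at most [m] times [kappa * b ^+ J]; the cube
    itself adds [eps]. *)
Let radius J : R := eps + N%:R * (m%:R * (kappa * b ^+ J)).

(* Translating levels w v I by the vector B X(v), whose image under A is that
   of X(v), makes the overlap of the translates that of the measurements. *)
Let packing w J (I : {set 'I_J}) :
  (\sum_(v : J.-tuple C) mu (levels w v I) <=
   ((\prod_(i < J) (if i \in I then beta else #|C|))%:R *
     ((2 * radius J / eps) ^+ m * eps ^+ N))%:E)%E.
Proof.
have [B [S [AB Sm BS Bm]]] := bounded_column_selection (A w).
pose u (v : J.-tuple C) (l : 'I_N) : R := - (B *m X v) l 0.
have uE (v : J.-tuple C) t :
    col_of_tuple (translate (u v) t) = col_of_tuple t - B *m X v.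
  by apply/colP => l; rewrite !mxE tnth_mktuple /u mxE.
(* A preimage, so [H v] is the set moved by [+ B *m X v], whence the sign in [u]. *)
pose H v := translate (u v) @^-1` levels w v I.
have mH v : measurable (H v).
  rewrite -[X in measurable X]setTI; apply: measurable_translate => //.
rewrite (eq_bigr (fun v => mu (H v))); last by move=> v _; rewrite mu_translate.
have er : eps <= radius J.
  by rewrite /radius lerDl !mulr_ge0 ?exprn_ge0 ?(le_trans _ b1).
have uS v l : l \notin S -> u v l = 0.
  by move=> lS; rewrite /u mxE big1 ?oppr0 // => q _; rewrite BS // mul0r.
have uB v l : `|u v l| <= radius J - eps.
  rewrite /u normrN mxE; apply: le_trans (ler_norm_sum _ _ _) _.
  rewrite /radius addrC addKr -[N in N%:R](card_ord N) -sumr_const mulr_suml.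
  apply: ler_sum => q _; rewrite mul1r normrM; apply: ler_pM => //.
  by have := X_bound v q; rewrite size_tuple.
have Hslab v : H v `<=` slab S (radius J).
  move=> t [Qt _] l; have := Qt l; rewrite tnth_mktuple.
  have := uB v l; rewrite ler_norml; case: ifPn => lS; first by lra.
  by rewrite (uS v l lS) addr0.
apply: (@le_trans _ _ (\sum_(v : J.-tuple C) 1%:E * mu (H v))%E).
  by apply: lee_sum => v _; rewrite mul1e.
set L := (\prod_(i < J) _)%N.
apply: (@le_trans _ _ (\sum_(j < 1) L%:R%:E * mu (slab S (radius J)))%E); last first.
  rewrite big_ord1 EFinM; apply: lee_wpmul2l; first by rewrite lee_fin.
  exact: slab_measure.
apply: le_sum_measure => //; first by move=> _; exact: measurable_box.
move=> p; rewrite big_ord1.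
have [pS|pS] := pselect (slab S (radius J) p); last first.
  rewrite big1 ?mulr_ge0// => v _.
  by rewrite indicE memNset ?mulr0// => Hp; apply: pS; exact: Hslab Hp.
rewrite [in leRHS]indicE mem_set// mulr1.
(* If [p] is in [H v], then [t = p - B *m X v] is in [levels w v I], and [X v + t] has the same
   image under [A w] as [p], because [A w *m B = A w]. So all translates through [p] share one
   measurement. *)
apply: le_trans (_ : #|[set v : J.-tuple C | `[< exists2 t, levels w v I t &
       A w *m (X v + col_of_tuple t) = A w *m col_of_tuple p >]]|%:R <= _).
  rewrite -sum1_card natr_sum [leRHS]big_mkcond/=; apply: ler_sum => v _.
  rewrite mul1r indicE; case: (boolP (p \in H v)) => [|_]; last by case: ifP.
  rewrite inE => Hp; rewrite ifT//.
  rewrite inE; apply/asboolP; exists (translate (u v) p) => //.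
  by rewrite uE mulmxDr mulmxBr mulmxA AB addrC subrK.
by rewrite ler_nat; exact: overlap.
Qed.

(** The fraction 5/8 lies strictly between the guaranteed 3/4 and the 1/2 that failing on half of
    the levels would allow. *)
Let success_count J : (0 < J)%N -> exists w,
  ((5 / 8 * (#|{: (J + J).-tuple C * 'I_(J + J)}|)%:R * eps ^+ N)%:E <=
   \sum_(vi : (J + J).-tuple C * 'I_(J + J)) mu (level w vi.1 vi.2))%E.
Proof.
move=> J0.
have C0 : (0 < #|C|)%N := leq_trans beta0 beta_le.
pose S (vi : (J + J).-tuple C * 'I_(J + J)) :=
  [set p : T * N.-tuple R | good p.1 (X (take vi.2.+1 vi.1) + col_of_tuple p.2)].
have mQ : measurable Q by exact: measurable_box.
have muQ : mu Q = (eps ^+ N)%:E.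
  rewrite mu_box; last by move=> _; exact: ltW.
  by under eq_bigr do rewrite subr0; rewrite prodr_const card_ord.
have [||||||w Hw] := @exists_good_outcome _ _ T _ R P mu Q _ S (3/4) (5/8) _ mQ muQ.
- exact: exprn_gt0.
- lra.
- lra.
- by rewrite card_prod card_tuple card_ord muln_gt0 expn_gt0 C0 addn_gt0 J0.
- by move=> vi; exact: good_measurable.
- move=> vi t Qt; apply: le_trans (good_likely (take vi.2.+1 vi.1) Qt) _.
  by rewrite le_eqVlt; apply/orP; left; apply/eqP; congr (P _); apply/seteqP;
    split=> w; rewrite /ysection/= inE.
exists w; apply: le_trans Hw _; apply: lee_sum => vi _.
rewrite le_eqVlt; apply/orP; left; apply/eqP; congr (mu _).
by apply/seteqP; split=> t; rewrite /level/xsection/= inE.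
Qed.

(* If at most J of the J + J levels succeed, the count is charged to the empty
   set of levels, otherwise to the set of all successful levels. *)
Let weight J (I : {set 'I_(J + J)}) : R :=
  if (J <= #|I|)%N then (J + J)%:R else if I == finset.set0 then J%:R else 0.

Let weight_ge0 J (I : {set 'I_(J + J)}) : 0 <= weight I.
Proof. by rewrite /weight; case: ifP => // _; case: ifP. Qed.

Let level_count w J : (0 < J)%N ->
  (\sum_(vi : (J + J).-tuple C * 'I_(J + J)) mu (level w vi.1 vi.2) <=
   \sum_(vI : (J + J).-tuple C * {set 'I_(J + J)})
     (weight vI.2)%:E * mu (levels w vI.1 vI.2))%E.
Proof.
move=> J0.
apply: (@le_trans _ _ (\sum_(vi : (J + J).-tuple C * 'I_(J + J))
    1%:E * mu (level w vi.1 vi.2))%E).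
  by apply: lee_sum => vi _; rewrite mul1e.
apply: le_sum_measure => // t.
rewrite -(pair_bigA _ (fun v i => 1 * \1_(level w v i) t))/=.
rewrite -(pair_bigA _ (fun v (I : {set 'I_(J + J)}) =>
  weight I * \1_(levels w v I) t))/=.
apply: ler_sum => v _.
have [Qt|nQt] := pselect (Q t); last first.
  rewrite big1.
    by apply: sumr_ge0 => I _; rewrite mulr_ge0.
  by move=> i _; rewrite indicE memNset ?mulr0// => -[].
pose I0 := [set i : 'I_(J + J) | t \in level w v i]%SET.
have -> : \sum_i 1 * \1_(level w v i) t = #|I0|%:R :> R.
  rewrite -sum1_card natr_sum [RHS]big_mkcond/=; apply: eq_bigr => i _.
  by rewrite mul1r indicE inE; case: (_ \in _).
have [JI|IJ] := leqP J #|I0|.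
  rewrite (bigD1 I0)//= {1}/weight JI indicE mem_set; last first.
    by split=> // i; rewrite inE => /set_mem.
  rewrite mulr1; apply: (@le_trans _ _ (J + J)%:R).
    by rewrite ler_nat; have := max_card (mem I0); rewrite card_ord.
  rewrite lerDl; apply: sumr_ge0 => I _.
  by rewrite mulr_ge0.
rewrite (bigD1 finset.set0)//= {1}/weight cards0 leqNgt J0/= eqxx indicE.
rewrite mem_set; last first.
  by split=> // i; rewrite finset.in_set0.
rewrite mulr1; apply: (@le_trans _ _ J%:R); first by rewrite ler_nat ltnW.
rewrite lerDl; apply: sumr_ge0 => I _.
by rewrite mulr_ge0.
Qed.

(** The empty set of levels accounts for at most [J] of the [5/4 * J] levels that succeed on
    average; the sets of at least [J] levels carry the rest, and [packing] bounds each of them. *)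
Let packing_at J : (0 < J)%N ->
  (#|C|%:R : R) ^+ (J + J) <=
  8 * (2 ^+ (J + J) * ((beta%:R * #|C|%:R) ^+ J * (2 * radius (J + J) / eps) ^+ m)).
Proof.
move=> J0; have [w Hw] := success_count J0.
have q0 : 0 < eps ^+ N by exact: exprn_gt0.
have eps_ge0 : 0 <= eps := ltW eps0.
have b_ge0 : 0 <= b := le_trans ler01 b1.
have muQ : mu Q = (eps ^+ N)%:E.
  rewrite mu_box; last by move=> _; exact: ltW.
  by under eq_bigr do rewrite subr0; rewrite prodr_const card_ord.
set rr := 2 * radius (J + J) / eps.
pose LL : R := (beta%:R * #|C|%:R) ^+ J * (rr ^+ m * eps ^+ N).
have rr0 : 0 <= rr.
  by rewrite divr_ge0// mulr_ge0// addr_ge0// !mulr_ge0// exprn_ge0.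
have LL0 : 0 <= LL.
  apply: mulr_ge0; first by rewrite exprn_ge0// mulr_ge0.
  by apply: mulr_ge0; exact: exprn_ge0.
have := le_trans Hw (level_count w J0).
rewrite -(pair_bigA _ (fun v (I : {set 'I_(J + J)}) =>
  ((weight I)%:E * mu (levels w v I))%E))/=.
rewrite exchange_big/= => HJ.
(* The bound with [LL] is added for every [I], so that the sum over [I] is immediate. *)
have {HJ} : ((5 / 8 * #|{: (J + J).-tuple C * 'I_(J + J)}|%:R * eps ^+ N)%:E <=
   \sum_(I : {set 'I_(J + J)})
     ((if I == finset.set0 then J%:R * (#|C|%:R ^+ (J + J) * eps ^+ N) else 0) +
      (J + J)%:R * LL)%:E)%E.
  apply: le_trans HJ _; apply: lee_sum => I _.
  rewrite -ge0_sume_distrr; last by move=> v _; exact: measure_ge0.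
  rewrite /weight; case: ifPn => [JI|_].
    apply: (@le_trans _ _ ((J + J)%:R * LL)%:E).
      rewrite EFinM; apply: lee_wpmul2l; first by rewrite lee_fin.
      apply: le_trans (packing w I) _; rewrite lee_fin.
      rewrite /LL; apply: ler_wpM2r.
        by rewrite mulr_ge0 ?exprn_ge0.
      by rewrite -natrM -natrX ler_nat; exact: prod_two_values_le.
    rewrite lee_fin lerDr; case: ifP => // _.
    by rewrite !mulr_ge0 ?exprn_ge0.
  case: ifPn => [_|_]; last first.
    by rewrite mul0e lee_fin add0r mulr_ge0.
  apply: (@le_trans _ _ (J%:R * (#|C|%:R ^+ (J + J) * eps ^+ N))%:E).
    rewrite EFinM; apply: lee_wpmul2l; first by rewrite lee_fin.
    apply: (@le_trans _ _ (\sum_(v : (J + J).-tuple C) (eps ^+ N)%:E)%E).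
      apply: lee_sum => v _; rewrite -muQ; apply: le_measure; rewrite ?inE//.
        exact: measurable_box.
      by move=> t [].
    by rewrite sumEFin sumr_const card_tuple lee_fin -natrX mulr_natl.
  by rewrite lee_fin lerDl mulr_ge0.
rewrite sumEFin lee_fin big_split/= -big_mkcond big_pred1_eq sumr_const.
have -> : #|{set 'I_(J + J)}| = (2 ^ (J + J))%N.
  by rewrite -cardsT -powersetT card_powerset cardsT card_ord.
have J0' : (0 : R) < J%:R by rewrite ltr0n.
rewrite card_prod card_tuple card_ord natrM natrX natrD -[_ *+ (2 ^ _)]mulr_natl natrX.
move=> /(success_arith J0'); rewrite /LL => HJ.
rewrite -(ler_pM2r q0) -!mulrA; exact: HJ.
Qed.

(** The powers of the quotient of the two sides stay bounded as [J] grows, so the quotient is at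
    most 1. *)
Lemma nested_packing_with : #|C|%:R <= 4 * beta%:R * b ^+ (2 * m) :> R.
Proof.
have M0 : (0 : R) < #|C|%:R by rewrite ltr0n (leq_trans beta0).
have bt0 : (0 : R) < beta%:R by rewrite ltr0n.
have b0 : 0 < b by exact: lt_le_trans b1.
rewrite -[leRHS]mul1r -ler_pdivrMr; last by rewrite !mulr_gt0 ?exprn_gt0.
have x0 : 0 <= #|C|%:R / (4 * beta%:R * b ^+ (2 * m)).
  by rewrite divr_ge0 ?mulr_ge0 ?exprn_ge0 // ltW.
apply: (expr_bounded_le1 x0) => J J0.
apply: (@growth_arith _ _ _ _ (radius (J + J)) eps _ (N%:R * (m%:R * kappa)) J m
  M0 b1 bt0 eps0 _ _ erefl (packing_at J0)); first by rewrite !mulr_ge0.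
by rewrite /radius !mulrA.
Qed.

End with_measure.

Theorem nested_packing : #|C|%:R <= 4 * beta%:R * b ^+ (2 * m) :> R.
Proof.
have [mu [mu_box mu_translate]] := tuple_lebesgue_exists R N.
exact: nested_packing_with mu_box mu_translate.
Qed.

End nested_packing.

(** * Recovery schemes as nested packings *)

Lemma nest_bound (R : realType) (D : nat) (n s : nat)
    (f : @codeword n s -> 'M[R]_D) (b kappa : R) w i j :
  2 <= b -> 0 <= kappa -> (forall c i j, 0 <= f c i j <= kappa) ->
  0 <= nest b f w i j <= kappa * b ^+ size w.
Proof.
move=> b2 k0 fk.
(* The induction needs the [- 1]: a new level adds [kappa], which [2 <= b] absorbs. *)
suff : 0 <= nest b f w i j <= kappa * (b ^+ size w - 1).
  by move=> /andP[-> h] /=; apply: le_trans h _; apply: ler_wpM2l => //; lra.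
elim: w => [|c w IH] /=; first by rewrite mxE expr0; lra.
rewrite !mxE exprS; have := fk c i j; move: IH.
set x := nest _ _ _ _ _; set z := f _ _ _; set p := b ^+ _.
move=> /andP[x0 xp] /andP[z0 zk].
have bx : b * x <= b * (kappa * (p - 1)) by apply: ler_wpM2l => //; lra.
have bx0 : 0 <= b * x by apply: mulr_ge0 => //; lra.
have kb : 0 <= kappa * (b - 2) by apply: mulr_ge0 => //; lra.
apply/andP; split; nra.
Qed.

Lemma mx_of_tupleE (R : realType) (D : nat) (t : (D * D).-tuple R) :
  mx_of_tuple t = vec_mx (col_of_tuple t)^T.
Proof. by congr vec_mx; apply/rowP => l; rewrite !mxE. Qed.

Lemma scheme_packing (R : realType) d (T : measurableType d) (P : probability T R)
    (D k m n s g l : nat) (K : R) (A : T -> 'M[R]_(m, D * D))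
    (rec : T -> 'cV[R]_m -> 'M[R]_D) :
  0 <= K -> (0 < D)%N -> (0 < n)%N -> (0 < s)%N -> (n + n <= k)%N ->
  (g * l <= D)%N -> (3 ^ s <= l)%N -> (n <= g * g)%N ->
  (2 ^ n * s ^ n./2 <= s ^ n)%N ->
  sparse_recovery_scheme P k K A rec ->
  (s ^ n)%:R <= 4 * (2 ^ n * s ^ n./2)%:R * (16 * K + 17) ^+ (2 * m).
Proof.
move=> K0 D0 n0 s0 nk gl sl ng bM [smeas sprob].
(* This is [1 + 2 * L * (K + 1)] with the Lipschitz constant [L = 8] of the bumps; [eps] below makes
   the noise condition of [mem_consistent] an equality. *)
pose b : R := 16 * K + 17.
have b2 : 2 <= b by rewrite /b; lra.
have b1 : 1 < b by lra.
pose eps : R := (2 * D%:R ^+ 3 * (b - 1))^-1.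
have D0' : (0 : R) < D%:R by rewrite ltr0n.
have den0 : 0 < 2 * D%:R ^+ 3 * (b - 1).
  by rewrite !mulr_gt0 ?exprn_gt0// subr_gt0.
have eps0 : 0 < eps by rewrite invr_gt0.
pose ht (i : 'I_s) : R := (3 ^ i)%:R.
have ht1 i : 1 <= ht i by rewrite ler1n expn_gt0.
have ht0 i : 0 < ht i by apply: lt_le_trans (ht1 i).
pose leaf := grid_leaf gl sl ng.
pose ctr : 'I_n -> Defs.point (D := D) := grid_center gl sl ng.
pose F (i : 'I_n * 'I_s) (p : Defs.point (D := D)) : R := (grid_bump g l i p)%:R.
pose X w : 'cV[R]_(D * D) := (mxvec (nest b (word leaf ht) w))^T.
(* Non-negativity is included to match the set whose measurability the scheme provides. *)
pose good w (v : 'cV[R]_(D * D)) :=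
  nonneg (vec_mx v^T) /\ good_output k K (vec_mx v^T) (rec w (A w *m v)).
have vecX w t :
    vec_mx (X w + col_of_tuple t)^T = nest b (word leaf ht) w + mx_of_tuple t.
  by rewrite linearD /= linearD /= /X trmxK mxvecK mx_of_tupleE.
have nestB w i j : 0 <= nest b (word leaf ht) w i j <= n%:R * b ^+ size w.
  apply: nest_bound => // c i' j'; rewrite word_ge0//=.
  rewrite summxE -[n in n%:R]card_ord -sumr_const; apply: ler_sum => a _.
  rewrite mxE mulr_ile1 ?invr_ge0 ?(ltW (ht0 _)) ?invf_le1//.
    exact: unit_mass_ge0.
  by rewrite mxE; case: (_ && _).
have tbox t : box (fun=> 0) (fun=> eps) t ->
    forall i j, 0 <= (mx_of_tuple t : 'M[R]_D) i j <= eps.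
  by move=> tb i j; rewrite !mxE; exact: tb.
have cw : #|@codeword n s| = (s ^ n)%N by rewrite card_ffun !card_ord.
rewrite -cw.
apply: (@nested_packing R d T P (D * D) m A (@codeword n s) X good b n%:R eps) => //.
- exact: ltW.
- by rewrite muln_gt0 !expn_gt0 s0.
- by rewrite cw.
- by move=> w w'; rewrite /X nest_cat linearD /= linearD /= !linearZ.
- move=> w q; rewrite /X mxE.
  have [i j] := mxvec_indexP q; rewrite mxvecE.
  by have /andP[x0 xb] := nestB w i j; rewrite ger0_norm.
- move=> w.
  (* Adding the fixed vector [X w] to the noise is measurable, so the event is a preimage of the
     jointly measurable success set. *)
  pose sh (p : T * (D * D).-tuple R) := (p.1, translate (fun q => X w q 0) p.2).
  have msh : measurable_fun setT sh.
    apply: measurable_fun_pair => //.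
    exact: (measurableT_comp (measurable_translate _) measurable_snd).
  rewrite (_ : [set p | _] = sh @^-1` [set p : T * (D * D).-tuple R |
    nonneg (mx_of_tuple p.2) /\ good_output k K (mx_of_tuple p.2)
      (rec p.1 (A p.1 *m (mxvec (mx_of_tuple p.2))^T))]).
    by rewrite -[X in measurable X]setTI; exact: msh.
  have cE t : col_of_tuple (translate (fun q => X w q 0) t) = X w + col_of_tuple t.
    by apply/colP => q; rewrite !mxE tnth_mktuple addrC !mxE.
  by apply/seteqP; split=> p; rewrite /good/= !mx_of_tupleE cE vec_mxK trmxK.
- move=> w t tb.
  have xnn : nonneg (nest b (word leaf ht) w + mx_of_tuple t).
    move=> i j; rewrite mxE addr_ge0//; first by case/andP: (nestB w i j).
    by case/andP: (tbox t tb i j).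
  apply: le_trans (sprob _ xnn) _.
  rewrite le_eqVlt; apply/orP; left; apply/eqP; congr (P _).
  have mvE : (mxvec (nest b (word leaf ht) w + mx_of_tuple t))^T = X w + col_of_tuple t.
    by rewrite -vecX vec_mxK trmxK.
  by apply/seteqP; split=> o; rewrite /good/= vecX mvE; [split|case].
- move=> o i y.
  exists (consistent F (b ^+ i) (rec o y)); split.
    by apply: card_consistent => //; rewrite exprn_gt0//; lra.
  move=> w c t wi tb [_]; rewrite vecX => Hg Ay.
  rewrite Ay in Hg; rewrite -wi.
  apply: (@mem_consistent _ _ _ _ leaf ctr F ht 8 _ _ _ _ _ _ _ b1 k K eps
    w c (mx_of_tuple t)) => //.
  - by move=> a q; exact: grid_dist.
  - by move=> q a q'; exact: grid_bump_leaf.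
  - by move=> q a; rewrite /F grid_bump_center.
  - by move=> p q; exact: grid_bump_lipschitz.
  - by rewrite /b; ring.
  - by rewrite /eps mulrAC divff// gt_eqF.
  - by move=> i' j'; case/andP: (tbox t tb i' j').
  - by move=> i' j'; case/andP: (tbox t tb i' j').
Qed.

(** * Choice of parameters *)

Lemma square_above (n : nat) : (0 < n)%N ->
  exists g, (n <= g * g)%N && (g * g <= 4 * n)%N.
Proof.
move=> n0.
have ex : exists g, (n <= g * g)%N by exists n; rewrite leq_pmulr.
case: (ex_minnP ex) => g ng gmin; exists g; rewrite ng/=.
case: g ng gmin => [|[|g]] ng gmin; [by []|by lia|].
(* The minimal root is now [g.+2], so [g.+1] fails, and [g.+2] is at most twice [g.+1]. *)
have h : (g.+1 * g.+1 < n)%N by rewrite ltnNge; apply/negP => /gmin; rewrite ltnn.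
by nia.
Qed.

(** Ensures that the decoded list is not larger than the code: [2 ^ n] is at most 4, hence [s], to
    the power [n - n./2]. *)
Lemma half_power_le (n s : nat) : (4 <= s)%N -> (2 ^ n * s ^ n./2 <= s ^ n)%N.
Proof.
move=> s4; have nE : (n = (n - n./2) + n./2)%N by lia.
rewrite {3}nE expnD leq_mul2r; apply/orP; right.
apply: (@leq_trans (4 ^ (n - n./2))).
  by rewrite -[4%N]/(2 ^ 2)%N -expnM leq_exp2l//; lia.
by case: (n - n./2)%N => // e; rewrite leq_exp2r.
Qed.

(** From [D < 2 * l * g], [l < 3 ^ s.+1] and [g * g <= 2 * k] follows [D ^ 2 <= 8 * k * 9 ^ s.+1],
    so the logarithm is at most [8 * (s + 2)]; being above 1024, it absorbs the 2. *)
Lemma leaf_count (R : realType) (D k n g l s : nat) :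
  (0 < k)%N -> (n + n <= k)%N -> (g * g <= 4 * n)%N -> (0 < g)%N -> (0 < D)%N ->
  l = (D %/ g)%N -> s = trunc_log 3 l ->
  1024 < ln (D%:R ^+ 2 / k%:R : R) ->
  [/\ (0 < l)%N & ln (D%:R ^+ 2 / k%:R) / 16 <= s%:R :> R].
Proof.
move=> k0 nk gn g0 D0 lE sE; set La := ln _ => La0.
have k0' : (0 : R) < k%:R by rewrite ltr0n.
have D0' : (0 : R) < D%:R by rewrite ltr0n.
have q0 : (0 : R) < D%:R ^+ 2 / k%:R by rewrite divr_gt0 ?exprn_gt0.
have q2 : 2 <= D%:R ^+ 2 / k%:R :> R.
  have h : -1 < D%:R ^+ 2 / k%:R - 1 :> R by lra.
  have := le_ln1Dx h; rewrite addrCA subrr addr0 -/La; lra.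
have Dk : (2 * k <= D * D)%N.
  by move: q2; rewrite ler_pdivlMr// expr2 -!natrM ler_nat.
have gD : (g <= D)%N by rewrite -leq_sqr -!mulnn; lia.
have l0 : (0 < l)%N by rewrite lE divn_gt0.
split=> //.
have Dl : (D < 2 * (l * g))%N.
  have := ltn_ceil D g0; rewrite -lE; nia.
have ls : (l < 3 ^ s.+1)%N by rewrite sE trunc_log_ltn.
have Dk8 : (D * D <= k * 9 ^ s.+2)%N.
  have e9 : (9 ^ s.+2 = 9 * (3 ^ s.+1 * 3 ^ s.+1))%N by rewrite expnS -expnMn.
  rewrite e9; set p := (3 ^ s.+1)%N in ls *.
  have h1 : (D * D <= 4 * (l * l) * (g * g))%N by nia.
  have h2 : (l * l <= p * p)%N by nia.
  have h3 : (g * g <= 2 * k)%N by lia.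
  apply: leq_trans h1 _; apply: (@leq_trans (4 * (p * p) * (2 * k))); last by nia.
  by apply: leq_mul => //; rewrite leq_mul2l h2.
have : La <= ln ((9 : R) ^+ s.+2).
  rewrite /La ler_ln ?posrE ?exprn_gt0// ler_pdivrMr// expr2 -natrX -!natrM ler_nat.
  by rewrite mulnC.
rewrite lnXn// => h.
have l9 : ln (9 : R) <= 8.
  have := @le_ln1Dx R 8 _; rewrite (_ : 1 + 8 = 9); last by ring.
  by apply; lra.
have : La <= 8 * s.+2%:R.
  apply: le_trans h _; rewrite -[leLHS]mulr_natr; exact: ler_wpM2r.
rewrite -[s.+2]addn2 natrD; lra.
Qed.

(** Squaring turns [n./2] into at most [n], giving [s ^ n <= 16 * 4 ^ n * b ^ (4 * m)]; the
    constants are absorbed by [64 ^ n]. *)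
Lemma packing_ln (R : realType) (n s m : nat) (y b : R) :
  (0 < n)%N -> 1 < y -> 64 * y <= s%:R -> 1 <= b ->
  (s ^ n)%:R <= 4 * (2 ^ n * s ^ n./2)%:R * b ^+ (2 * m) ->
  n%:R * ln y <= 4 * m%:R * ln b.
Proof.
move=> n0 y1 ys b1; rewrite natrM !natrX => H.
have s1 : 1 <= s%:R :> R by lra.
have s0 : 0 < s%:R :> R by lra.
have b0 : 0 < b by lra.
have Hs : s%:R ^+ n <= 16 * 4 ^+ n * b ^+ (4 * m) :> R.
  rewrite -(ler_pM2l (exprn_gt0 n s0)) -expr2.
  apply: (@le_trans _ _ ((4 * (2 ^+ n * s%:R ^+ n./2) * b ^+ (2 * m)) ^+ 2)).
    have p0 : 0 <= s%:R ^+ n :> R by exact: exprn_ge0.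
    by apply: lerXn2r => //; rewrite nnegrE// (le_trans p0 H).
  have sh : (s%:R : R) ^+ (n./2 * 2) <= s%:R ^+ n.
    by apply: ler_weXn2l => //; lia.
  have -> : (4 * (2 ^+ n * s%:R ^+ n./2) * b ^+ (2 * m)) ^+ 2 =
      s%:R ^+ (n./2 * 2) * (16 * 4 ^+ n * b ^+ (4 * m)) :> R.
    have -> : (4 : R) ^+ n = (2 ^+ n) ^+ 2 by rewrite exprAC; congr (_ ^+ _); ring.
    have -> : (4 * m = (2 * m) * 2)%N by lia.
    rewrite !(exprM _ _ 2); ring.
  by apply: ler_wpM2r => //; rewrite !mulr_ge0 ?exprn_ge0// ltW.
have yn : y ^+ n <= b ^+ (4 * m).
  have h16 : (16 : R) <= 16 ^+ n by rewrite -[leLHS]expr1; apply: ler_weXn2l => //; lra.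
  rewrite -(@ler_pM2l _ (64 ^+ n)) ?exprn_gt0// -exprMn.
  apply: (@le_trans _ _ (s%:R ^+ n)).
    by apply: lerXn2r => //; rewrite nnegrE; lra.
  apply: le_trans Hs _; apply: ler_wpM2r; first by rewrite exprn_ge0// ltW.
  have -> : (64 : R) ^+ n = 16 ^+ n * 4 ^+ n.
    by rewrite -exprMn; congr (_ ^+ _); ring.
  by apply: ler_wpM2r => //; rewrite exprn_ge0.
have y0 : 0 < y by lra.
have : ln (y ^+ n) <= ln (b ^+ (4 * m)) by rewrite ler_ln ?posrE ?exprn_gt0.
by rewrite !lnXn// -[_ *+ n]mulr_natl -[_ *+ (4 * m)]mulr_natl natrM.
Qed.

Theorem mainTheorem14 (R : realType) (K0 : R) (hK0 : 1 < K0) :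
  exists c1 c2 : R, [/\ 0 < c1, 0 < c2 &
    forall (D k m : nat) (K : R)
      (d : measure_display) (T : measurableType d) (P : probability T R)
      (A : T -> 'M[R]_(m, D * D)) (rec : T -> 'cV[R]_m -> 'M[R]_D),
      (1 < k)%N -> (1 <= D)%N -> K0 <= K ->
      sparse_recovery_scheme P k K A rec ->
      c1 * k%:R * ln (c2 * ln (D%:R ^+ 2 / k%:R)) / ln K <= m%:R].
Proof.
have lnK0 : 0 < ln K0 by rewrite ln_gt0.
(* Chosen so that [ln (16 * K + 17) <= 32 + ln K <= c * ln K]; this is where [K] must stay away from
   1. *)
pose c : R := 32 / ln K0 + 1.
have c0 : 0 < c by rewrite addr_gt0// divr_gt0.
(* 12 is the 4 of [packing_ln] times the 3 of [k <= 3 * n]; 1024 is the 64 of [packing_ln] times the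
   16 of [leaf_count]. *)
exists (12 * c)^-1, 1024^-1.
split; [by rewrite invr_gt0 mulr_gt0 | by rewrite invr_gt0 ltr0n | ].
move=> D k m K d T P A rec k1 D1 K0K scheme.
have K1 : 1 < K by exact: lt_le_trans K0K.
have lnK : 0 < ln K by rewrite ln_gt0.
set y := 1024^-1 * ln _.
(* For [y <= 1] the bound is at most 0, also for [y <= 0], where [ln y] is 0 by convention. *)
have [y1|y1] := leP y 1.
  have lny : ln y <= 0 by rewrite ln_le0.
  apply: (@le_trans _ _ 0); last exact: ler0n.
  rewrite pmulr_lle0 ?invr_gt0// pmulr_rle0//.
  by rewrite mulr_gt0 ?invr_gt0 ?mulr_gt0// ltr0n ltnW.
pose n := k./2.
have n0 : (0 < n)%N by rewrite /n; lia.
have nk : (n + n <= k)%N by rewrite /n; lia.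
have k3 : k%:R <= 3 * n%:R :> R by rewrite -natrM ler_nat /n; lia.
have [g /andP[ng gn]] := square_above n0.
have g0 : (0 < g)%N by case: (g) ng => //; rewrite leqNgt n0.
pose l := (D %/ g)%N; pose s := trunc_log 3 l.
have La : 1024 < ln (D%:R ^+ 2 / k%:R : R) by move: y1; rewrite /y; lra.
have [l0 sy] := leaf_count (ltnW k1) nk gn g0 D1 (erefl l) (erefl s) La.
have s64 : 64 * y <= s%:R by move: sy; rewrite /y; lra.
clear La sy; clearbody y.
have s4 : (4 <= s)%N by rewrite -(ler_nat R); lra.
have bM := half_power_le n s4.
have HK : 0 <= K by lra.
have gl : (g * l <= D)%N by rewrite mulnC leq_trunc_div.
have sl : (3 ^ s <= l)%N by rewrite trunc_logP.
have H := scheme_packing HK D1 n0 (ltn_trans (isT : 0 < 3)%N s4) nk gl sl ng bM scheme.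
have b1 : 1 <= 16 * K + 17 by lra.
have Hm := packing_ln n0 y1 s64 b1 H.
have lnb : ln (16 * K + 17) <= c * ln K.
  apply: (@le_trans _ _ (ln (33 * K))); first by rewrite ler_ln ?posrE; lra.
  rewrite lnM ?posrE; [|lra|lra].
  have l33 : ln (33 : R) <= 32.
    have := @le_ln1Dx R 32 _; rewrite (_ : 1 + 32 = 33); last by ring.
    by apply; lra.
  have lK : ln K0 <= ln K by rewrite ler_ln ?posrE; lra.
  rewrite /c mulrDl mul1r lerD2r; apply: le_trans l33 _.
  rewrite mulrAC ler_pdivlMr//; apply: ler_wpM2l => //.
have lny : 0 <= ln y by rewrite ln_ge0// ltW.
rewrite ler_pdivrMr// -mulrA mulrC ler_pdivrMr; last by rewrite mulr_gt0.
clear -Hm lnb lny k3 lnK c0.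
have h1 : k%:R * ln y <= 3 * (n%:R * ln y) by rewrite mulrA; apply: ler_wpM2r.
have h2 : 4 * m%:R * ln (16 * K + 17) <= 4 * m%:R * (c * ln K).
  by apply: ler_wpM2l => //; rewrite mulr_ge0.
lra.
Qed.
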